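(* Let $0<\alpha\le 1$ and let $\delta,\epsilon,p,q$ be real numbers. Consider the fractional order delay differential equation $$D^\alpha x(t)=\delta x(t-\tau)-\epsilon (x(t-\tau))^3-p(x(t))^2+qx(t)$$ and its equilibrium point $x_1^*=0$. If $\delta+q<0$ and $\delta\ge q$, then $x_1^*$ is asymptotically stable for all $\tau\ge 0$.
   Context: $D^\alpha$ denotes the Caputo fractional derivative: $D^1x=x'$, and for $0<\alpha<1$, $D^\alpha x(t)=\frac{1}{\Gamma(1-\alpha)}\int_0^t (t-s)^{-\alpha}x'(s)\,ds$. Initial data: $x(t)=\phi(t)$ for $-\tau\le t\le 0$, where $\phi:[-\tau,0]\to\mathbb{R}$; the corresponding solution is denoted $x(t,\phi)$, and $\|\phi\|=\sup_{-\tau\le t\le 0}|\phi(t)|$. (For $\tau=0$ the initial datum is just $x(0)$.) An equilibrium point is a steady state (constant) solution. An equilibrium point $x^*$ is stable if for every $\eta>0$ there is $\rho>0$ such that $\|\phi-x^*\|<\rho$ implies $|x(t,\phi)-x^*|<\eta$ for all $t\ge 0$. It is asymptotically stable if it is stable and there is $b_0>0$ such that $\|\phi-x^*\|<b_0$ implies $\lim_{t\to\infty}x(t,\phi)=x^*$. It is unstable if it is not stable. *)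

(* Defs.v *)
(* MathComp-Analysis world. *)
From HB Require Import structures.
From mathcomp Require Import all_boot all_order all_algebra.
From mathcomp Require Import all_classical all_reals all_analysis.
Import Order.TTheory GRing.Theory Num.Theory.
Import numFieldNormedType.Exports.

Set Implicit Arguments.
Unset Strict Implicit.
Unset Printing Implicit Defensive.

Local Open Scope classical_set_scope.
Local Open Scope ring_scope.

Definition Gamma (R : realType) (a : R) : R :=
  \int[@lebesgue_measure R]_(u in `]0, +oo[) (u `^ (a - 1) * expR (- u)).

Definition caputo_integrand (R : realType) (alpha : R) (x : R -> R) (t s : R) : R :=
  (t - s) `^ (- alpha) * derive1 x s.

Definition caputo (R : realType) (alpha : R) (x : R -> R) (t : R) : R :=
  if alpha == 1 then derive1 x t
  else (Gamma (1 - alpha))^-1 *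
       \int[@lebesgue_measure R]_(s in `[0, t]) caputo_integrand alpha x t s.

(* Derivative and integral are total operators: this predicate says that
   [caputo alpha x t] is not a default value. *)
Definition caputo_derivable (R : realType) (alpha : R) (x : R -> R) (t : R) : Prop :=
  if alpha == 1 then derivable x t 1
  else (@lebesgue_measure R).-integrable `[0, t]
         (fun s => (caputo_integrand alpha x t s)%:E).

(* Local absolute continuity on [0, T[, in its integral form.  Without it the
   equation would not determine x for alpha < 1: one could add to x a singular
   function, whose derivative vanishes almost everywhere.  Differentiability
   at every t > 0 would be too strong: for small alpha, solutions have cusps at
   multiples of the delay. *)
Definition locally_ac (R : realType) (T : \bar R) (x : R -> R) : Prop :=
  forall t : R, 0 <= t -> (t%:E < T)%E ->
    (@lebesgue_measure R).-integrable `[0, t] (EFin \o derive1 x) /\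
    x t = x 0 + \int[@lebesgue_measure R]_(s in `[0, t]) derive1 x s.

(* x solves D^alpha x(t) = f (x(t)) (x(t - tau)) on ]0, T[, with history phi on
   [-tau, 0]; T = +oo gives the global solutions. The values of x outside
   [-tau, T[ and those of phi outside [-tau, 0] are irrelevant. *)
Definition is_solution (R : realType) (alpha tau : R) (f : R -> R -> R)
    (phi : R -> R) (T : \bar R) (x : R -> R) : Prop :=
  [/\ forall t : R, - tau <= t <= 0 -> x t = phi t,
      locally_ac T x &
      forall t : R, 0 < t -> (t%:E < T)%E ->
        caputo_derivable alpha x t /\
        caputo alpha x t = f (x t) (x (t - tau))].

Definition hist_norm (R : realType) (tau : R) (phi : R -> R) : \bar R :=
  ereal_sup [set `|phi t|%:E | t in `[- tau, 0]].

Definition equilibrium (R : realType) (alpha tau : R) (f : R -> R -> R) (c : R) : Prop :=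
  is_solution alpha tau f (cst c) +oo%E (cst c).

(* The bound is required of every solution, on whatever interval [-tau, T[ it
   is defined, so that a solution blowing up in finite time is not ignored. *)
Definition stable (R : realType) (alpha tau : R) (f : R -> R -> R) (c : R) : Prop :=
  forall eta : R, 0 < eta -> exists2 rho : R, 0 < rho &
    forall phi : R -> R, (hist_norm tau (fun t => phi t - c)%R < rho%:E)%E ->
    forall (T : \bar R) (x : R -> R), is_solution alpha tau f phi T x ->
    forall t : R, 0 <= t -> (t%:E < T)%E -> `|x t - c| < eta.

Definition attractive (R : realType) (alpha tau : R) (f : R -> R -> R) (c : R) : Prop :=
  exists2 b0 : R, 0 < b0 &
    forall phi : R -> R, (hist_norm tau (fun t => phi t - c)%R < b0%:E)%E ->
    forall x : R -> R, is_solution alpha tau f phi +oo%E x ->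
    x t @[t --> +oo] --> c.

Definition asymptotically_stable (R : realType) (alpha tau : R)
    (f : R -> R -> R) (c : R) : Prop :=
  stable alpha tau f c /\ attractive alpha tau f c.

(* Arguments: u = x(t), v = x(t - tau). *)
Definition cubic_rhs (R : realType) (delta epsilon p q : R) (u v : R) : R :=
  delta * v - epsilon * v ^+ 3 - p * u ^+ 2 + q * u.

(* Main.v *)
Require Import Defs.
From mathcomp Require Import all_boot all_order all_algebra.
From mathcomp Require Import all_classical all_reals all_analysis.
From mathcomp Require Import ring lra.
From mathcomp Require Import measurable_realfun.

(** Put [a = - q]. The hypotheses say [- a <= delta < a], and near [0] the equation
    reads [D^alpha x(t) = - a x(t) + delta x(t - tau)] up to quadratic terms. The
    delayed term never outweighs the instantaneous one. In the boundary case
    [delta = q] it can balance it, though: if [x(t) = K] is a maximum of [|x|] and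
    [x(t - tau) = - K], the linear part vanishes, and the maximum principle alone
    leaves the sign of the quadratic terms open.

    The proof compares [|x|] with a slow barrier [B t = K * (1 + k * t) `^ (- b)].
    If the history is below [K / 2], with [K] small, then [|x| <= B] for ever
    ([barrier_bound]); as [B <= K] and [B] tends to [0], this is stability and
    attractivity at once. Suppose that [x] touches [B] for the first time at [t0]
    (the case of [- x] is symmetric). Then [x - B] is maximal at [t0], so that its
    Caputo derivative is nonnegative there, whereas that of [B] is at least
    [- eta * B] with [eta] as small as desired ([decay'_abel], [decay'_ge]).
    Hence the right-hand side is almost nonnegative, and the linear part shows
    that [delta < 0] and that [x (t0 - tau)] is close to [- B t0]
    ([contact_delayed]). This is contradicted by the past of [x].

    For [alpha < 1], the Caputo derivative at a maximum is not just nonnegative: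
    it is a weighted integral, with positive weight, of how far the past lies below
    that maximum ([abel_at_max]). Hence [x] is close to [B] in the mean over the
    last delays, in particular just before [t0 - tau]. But over these
    delays [D^alpha x] is bounded by a multiple of [B t0], and this does not allow a
    sudden fall from [B t0] to [- B t0] ([no_sudden_drop]). For [alpha = 1] there is no
    such memory, but the equation gives [x' <= a (B t0 - x)] up to small terms
    between [t0 - tau] and [t0]; going backwards from [x t0 = B t0], this keeps [x]
    close to [B t0] down to [t0 - tau] ([ode_no_contact]). Contacts so early that
    these arguments would reach into the history are excluded by the initial gap
    between [K / 2] and [K]. *)

Import Order.TTheory GRing.Theory Num.Theory.
Import numFieldNormedType.Exports.

Set Implicit Arguments.
Unset Strict Implicit.
Unset Printing Implicit Defensive.

Local Open Scope classical_set_scope.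
Local Open Scope ring_scope.

Local Notation mu := (@lebesgue_measure _).

(** * Integrals of singular kernels *)

Lemma is_derive1_continuous (R : realType) (f : R -> R) (x df : R) :
  is_derive x 1 f df -> {for x, continuous f}.
Proof. by move=> [dx _]; exact/differentiable_continuous/derivable1_diffP. Qed.

Lemma FTC_derive (R : realType) (f F : R -> R) (a b : R) : a <= b ->
  (forall x, a <= x <= b -> is_derive x 1 F (f x)) ->
  (forall x, a <= x <= b -> {for x, continuous f}) ->
  (\int[mu]_(x in `[a, b]) (f x)%:E = (F b - F a)%:E)%E.
Proof.
rewrite le_eqVlt => /predU1P[-> _ _|ab dF cf].
  by rewrite set_itv1 integral_set1 subrr.
have itv x : x \in `]a, b[ -> a <= x <= b.
  by rewrite in_itv/= => /andP[/ltW -> /ltW ->].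
have cF x : a <= x <= b -> {for x, continuous F}.
  by move=> /dF; exact: is_derive1_continuous.
rewrite EFinB; apply: continuous_FTC2 => //.
- apply: continuous_in_subspaceT => x; rewrite inE/= in_itv/=; exact: cf.
- split.
  + by move=> x /itv /dF [].
  + by apply: cvg_at_right_filter; apply: cF; rewrite lexx ltW.
  + by apply: cvg_at_left_filter; apply: cF; rewrite lexx ltW.
- by move=> x /itv /dF [dx]; rewrite derive1E.
Qed.

Lemma continuous_itv_integrable (R : realType) (f : R -> R) (a b : R) :
  (forall x, a <= x <= b -> {for x, continuous f}) ->
  mu.-integrable `[a, b] (EFin \o f).
Proof.
move=> cf; apply: continuous_compact_integrable; first exact: segment_compact.
apply: continuous_in_subspaceT => x; rewrite inE/= in_itv/=; exact: cf.
Qed.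

(** Fundamental theorem of calculus for integrands that blow up at an end of the
    domain, by monotone convergence along segments that avoid it. An upper bound
    is all that is needed from it: it makes singular kernels integrable. *)
Lemma le_integral_exhaustion (R : realType) (f F : R -> R) (D : set R)
    (u v : nat -> R) (M : R) :
  (forall n, u n <= v n) -> nonincreasing_seq u -> nondecreasing_seq v ->
  D `<=` \bigcup_n `[u n, v n]%classic ->
  measurable D -> (forall n x, u n <= x <= v n -> 0 <= f x) ->
  (forall n x, u n <= x <= v n -> is_derive x 1 F (f x)) ->
  (forall n x, u n <= x <= v n -> {for x, continuous f}) ->
  (forall n, F (v n) - F (u n) <= M) ->
  mu.-integrable D (EFin \o f) /\ \int[mu]_(x in D) f x <= M.
Proof.
move=> uv du dv DE mD f0 dF cf FM.
have mf n : measurable_fun `[u n, v n]%classic (EFin \o f).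
  by apply: (measurable_int mu); apply: continuous_itv_integrable => x /cf.
have nd : nondecreasing_seq (fun n => `[u n, v n]%classic).
  move=> m n mn; rewrite subsetEset => x /=; rewrite !in_itv/= => /andP[ux xv].
  by rewrite (le_trans (du _ _ mn) ux) (le_trans xv (dv _ _ mn)).
have f0' n x : `[u n, v n]%classic x -> (0 <= (f x)%:E)%E.
  by rewrite /= in_itv/= lee_fin; exact: f0.
have bD : measurable (\bigcup_n `[u n, v n]%classic) by exact: bigcup_measurable.
have mbD : measurable_fun (\bigcup_n `[u n, v n]%classic) (EFin \o f).
  by apply/measurable_fun_bigcup => // n; exact: mf.
have f0D x : D x -> 0 <= f x by move=> /DE[n _] /f0'.
have leD : (\int[mu]_(x in D) (f x)%:E <= M%:E)%E.
  apply: (@le_trans _ _ (\int[mu]_(x in \bigcup_n `[u n, v n]%classic) (f x)%:E)%E).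
    apply: ge0_subset_integral => //.
    by move=> x [n _]; exact: f0'.
  have /cvg_lim <- // := @ge0_nondecreasing_set_cvg_integral _ _ R _ _ mu nd
    (fun=> measurable_itv _) mf f0'.
  apply: lime_le.
    apply: ereal_nondecreasing_is_cvgn.
    exact: ge0_nondecreasing_set_nondecreasing_integral.
  apply: nearW => n.
  by rewrite (FTC_derive (uv n) (dF n) (cf n)) lee_fin.
have ge0 : (0 <= \int[mu]_(x in D) (f x)%:E)%E.
  by apply: integral_ge0 => x Dx; rewrite lee_fin f0D.
have fin : (\int[mu]_(x in D) (f x)%:E)%E \is a fin_num.
  by rewrite ge0_fin_numE// (le_lt_trans leD)// ltry.
split.
  apply/integrableP; split; first exact: measurable_funS mbD.
  apply: le_lt_trans (ltry M); apply: le_trans leD.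
  rewrite le_eqVlt; apply/orP; left; apply/eqP/eq_integral => x.
  by rewrite inE => Dx /=; rewrite ger0_norm// f0D.
by rewrite -lee_fin fineK.
Qed.

Lemma powR_ratio (R : realType) (b x y : R) : 0 < x -> 0 < y ->
  (x / y) `^ (b - 1) * y ^- 2 = x `^ (b - 1) * y `^ (- b - 1).
Proof.
move=> x0 y0; rewrite powRM ?ltW ?invr_gt0// -mulrA; congr (_ * _).
have -> : y^-1 = y `^ (-1) by rewrite powR_inv1 ?ltW.
have -> : y ^- 2 = y `^ (- 2%:R) by rewrite powR_invn ?ltW.
rewrite -powRrM -powRD; last by rewrite (gt_eqF y0) implybT.
by congr (_ `^ _); ring.
Qed.

Lemma integrable_itv_bndo_bndc (R : realType) (f : R -> R) (a b : R) :
  mu.-integrable `[a, b[ (EFin \o f) -> mu.-integrable `[a, b] (EFin \o f).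
Proof.
move=> /integrableP[mf foo]; apply/integrableP; split.
  apply/measurable_EFinP/measurable_fun_itv_bndo_bndcP.
  exact/measurable_EFinP.
rewrite -integral_itv_bndo_bndc//.
by apply: measurableT_comp.
Qed.

Lemma is_derive_powR_comp (R : realType) (f : R -> R) (b df x : R) :
  0 < f x -> is_derive x 1 f df ->
  is_derive x 1 (fun y => f y `^ b) (b * f x `^ (b - 1) * df).
Proof.
move=> fx0 dfx.
have dp := is_derive1_powR b fx0.
by have := @is_derive1_comp _ (@powR R ^~ b) f x _ _ dp dfx; rewrite mulrC.
Qed.

(** The kernel [(t - s) `^ (b - 1)] against the density [(1 + k * s) `^ (- b - 1)]
    has the explicit primitive [- ((t - s) / (1 + k * s)) `^ b], up to a factor.
    For [k = 0] this is the integral of the kernel itself. *)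
Lemma decay_kernel (R : realType) (b k a t : R) : 0 < b -> 0 <= k ->
  0 <= a -> a < t ->
  mu.-integrable `[a, t]
    (EFin \o (fun s : R => (t - s) `^ (b - 1) * (1 + k * s) `^ (- b - 1))) /\
  \int[mu]_(s in `[a, t]) ((t - s) `^ (b - 1) * (1 + k * s) `^ (- b - 1)) <=
    ((t - a) / (1 + k * a)) `^ b / (b * (1 + k * t)).
Proof.
move=> b0 k0 a0 at0.
set f := fun s : R => _ * _.
pose F (s : R) := - (((t - s) / (1 + k * s)) `^ b / (b * (1 + k * t))).
pose v (n : nat) := t - (t - a) / n.+1%:R.
have ta0 : 0 < t - a by rewrite subr_gt0.
have pos s : a <= s -> 0 < 1 + k * s.
  by move=> as_; rewrite ltr_pwDl// mulr_ge0// (le_trans a0).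
have vt n : v n < t by rewrite /v ltrBlDr ltrDl divr_gt0.
have av n : a <= v n.
  rewrite /v lerBrDr addrC -lerBrDr ler_pdivrMr//.
  by rewrite ler_peMr ?(ltW ta0)// ler1n.
have nv : nondecreasing_seq v.
  move=> m n mn; rewrite /v lerD2l lerN2 ler_pM2l// lef_pV2 ?posrE//.
  by rewrite ler_nat ltnS.
have dF s : a <= s < t -> is_derive s 1 F (f s).
  move=> /andP[as_ st]; have ks := pos _ as_.
  have r0 : 0 < (t - s) / (1 + k * s) by rewrite divr_gt0 ?subr_gt0.
  have dr : is_derive s 1 (fun s : R => (t - s) / (1 + k * s))
      (- (1 + k * t) * (1 + k * s) ^- 2).
    apply: is_derive_eq; first by apply: is_deriveM; apply: is_deriveV; rewrite gt_eqF.
    rewrite /GRing.scale/=.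
    by field; rewrite gt_eqF.
  have := @is_derive_powR_comp _ (fun s => (t - s) / (1 + k * s)) b _ s r0 dr.
  move=> dp; rewrite /F /f.
  have kt : 0 < 1 + k * t by rewrite pos// ltW// (le_lt_trans as_).
  have -> : (fun s => - (((t - s) / (1 + k * s)) `^ b / (b * (1 + k * t)))) =
     (- (b * (1 + k * t))^-1) \*: (fun s => ((t - s) / (1 + k * s)) `^ b).
    by apply/funext => z /=; rewrite /GRing.scale/= mulNr mulrC.
  apply: is_derive_eq.
  rewrite /GRing.scale/= -powR_ratio ?subr_gt0//.
  by field; rewrite !gt_eqF.
have f0 s : a <= s -> 0 <= f s by move=> _; rewrite mulr_ge0 ?powR_ge0.
have itv s n : a <= s <= v n -> a <= s < t.
  by move=> /andP[-> sv]; rewrite (le_lt_trans sv).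
have [intf lef] : mu.-integrable `[a, t[ (EFin \o f) /\
    \int[mu]_(s in `[a, t[) f s <= ((t - a) / (1 + k * a)) `^ b / (b * (1 + k * t)).
  apply: (@le_integral_exhaustion R f F _ (fun=> a) v) => //.
  - move=> s /=; rewrite in_itv/= => /andP[as_ st].
    exists (Num.truncn ((t - a) / (t - s))) => //=.
    rewrite in_itv/= as_/= /v lerBrDr addrC -lerBrDr ler_pdivrMr//.
    rewrite mulrC -ler_pdivrMr ?subr_gt0// ltW//.
    by apply: truncnS_gt.
  - by move=> n s /itv /andP[/f0].
  - by move=> n s /itv; exact: dF.
  - move=> n s /itv /andP[as_ st].
    have ts0 : 0 < t - s by rewrite subr_gt0.
    have ks0 := pos _ as_.
    apply: (is_derive1_continuous (df := _)); rewrite /f.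
    apply: is_deriveM; last first.
      exact: (@is_derive_powR_comp _ (fun s => 1 + k * s) (- b - 1) _ s ks0 _).
    exact: (@is_derive_powR_comp _ (fun s => t - s) (b - 1) _ s ts0 _).
  - move=> n; rewrite /F opprK addrC lerBlDr lerDl divr_ge0 ?powR_ge0//.
    by rewrite mulr_ge0 ?ltW// pos// ltW.
split; first exact: integrable_itv_bndo_bndc.
by rewrite -Rintegral_itv_bndo_bndc//.
Qed.

Lemma abel_kernel_integral (R : realType) (al a t : R) :
  al < 1 -> 0 <= a -> a < t ->
  mu.-integrable `[a, t] (EFin \o (fun s : R => (t - s) `^ (- al))) /\
  \int[mu]_(s in `[a, t]) ((t - s) `^ (- al)) <= (t - a) `^ (1 - al) / (1 - al).
Proof.
move=> al1 a0 at0.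
have b0 : 0 < 1 - al by rewrite subr_gt0.
have [] := decay_kernel b0 (lexx 0) a0 at0.
have E : (fun s : R => (t - s) `^ (1 - al - 1) * (1 + 0 * s) `^ (- (1 - al) - 1)) =
    (fun s : R => (t - s) `^ (- al)).
  by apply/funext => s; rewrite mul0r addr0 powR1 mulr1; congr (_ `^ _); ring.
by rewrite E !mul0r !addr0 divr1 mulr1.
Qed.

Lemma integrable_abel_bounded (R : realType) (al a t M : R) (g : R -> R) :
  al < 1 -> 0 <= a -> a < t ->
  measurable_fun `[a, t] g -> (forall s, a <= s <= t -> `|g s| <= M) ->
  mu.-integrable `[a, t] (EFin \o (fun s : R => (t - s) `^ (- al) * g s)).
Proof.
move=> al1 a0 at0 mg gM.
have [ik _] := abel_kernel_integral al1 a0 at0.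
have := @integrableMl _ _ _ mu `[a, t]%classic _ _ g ik mg; apply => //.
exists M; split; first by rewrite num_real.
move=> x Mx s /=; rewrite in_itv/= => /gM /le_trans; apply; exact: ltW.
Qed.

(** The Caputo derivative of [(1 + k * t) `^ (- b)] is at least [- k `^ al] times
    the function itself. With [Y := (1 + k * t) / k >= t - s], the kernel
    [(t - s) `^ (- al)] is at most [Y `^ (1 - al - b) * (t - s) `^ (b - 1)], which
    [decay_kernel] integrates exactly; this gives the bound [Y `^ (- al)]. The
    condition [b <= al] is natural: because of the memory of the Caputo
    derivative, relaxation cannot be faster than [t `^ (- al)]. *)
Lemma caputo_decay_bound (R : realType) (al b k t : R) :
  0 < al -> 0 < b -> b <= al -> b <= 1 - al -> 0 < k -> 0 < t ->
  \int[mu]_(s in `[0, t]) ((t - s) `^ (- al) * (b * k * (1 + k * s) `^ (- b - 1)))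
  <= k `^ al * (1 + k * t) `^ (- b).
Proof.
move=> al0 b0 bal bal1 k0 t0.
have al1 : al < 1 by rewrite -subr_gt0 (lt_le_trans b0).
have kt0 : 0 < 1 + k * t by rewrite ltr_pwDl// mulr_ge0// ltW.
have bk0 : 0 < b * k by rewrite mulr_gt0.
set Y := (1 + k * t) / k.
have Y0 : 0 < Y by rewrite divr_gt0.
have [i1 l1] := decay_kernel b0 (ltW k0) (lexx 0) t0.
set f := (fun s : R => _) in i1 l1.
have i2 : mu.-integrable `[0, t] (EFin \o (fun s => (b * k * Y `^ (1 - al - b)) * f s)).
  by have := @integrableZl _ _ _ mu `[0, t]%classic _ (b * k * Y `^ (1 - al - b)) _ i1; apply.
have mg : measurable_fun `[0, t] (fun s : R => b * k * (1 + k * s) `^ (- b - 1)).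
  apply: measurable_funTS; apply: measurable_funM => //.
  apply: (measurableT_comp (measurable_powR _)).
  by apply: measurable_funD => //; apply: measurable_funM.
have ks s : 0 <= s -> 1 <= 1 + k * s.
  by move=> s0; rewrite lerDl mulr_ge0// ltW.
have i3 : mu.-integrable `[0, t]
   (EFin \o (fun s => (t - s) `^ (- al) * (b * k * (1 + k * s) `^ (- b - 1)))).
  apply: (@integrable_abel_bounded _ _ _ _ (b * k)) => //.
  move=> s /andP[s0 st].
  rewrite ger0_norm; last by rewrite mulr_ge0 ?powR_ge0// (ltW bk0).
  apply: ler_piMr; first exact: ltW.
  have -> : - b - 1 = - (b + 1) by ring.
  rewrite powRN invf_le1 ?powR_gt0 ?(lt_le_trans ltr01 (ks s s0))//.
  have := @ler_powR _ (1 + k * s) (ks s s0) 0 (b + 1).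
  by rewrite powRr0; apply; rewrite addr_ge0// ltW.
apply: (@le_trans _ _ (\int[mu]_(s in `[0, t]) ((b * k * Y `^ (1 - al - b)) * f s))).
  apply: le_Rintegral => // s /=; rewrite in_itv/= => /andP[s0 st].
  have [->|nst] := eqVneq s t.
    rewrite subrr powR0 ?oppr_eq0 ?gt_eqF// mul0r.
    by rewrite !mulr_ge0 ?powR_ge0// ltW.
  have ts0 : 0 < t - s by rewrite subr_gt0 lt_neqAle nst.
  have -> : (b * k * Y `^ (1 - al - b)) * f s = (Y `^ (1 - al - b) * (t - s) `^ (b - 1)) *
      (b * k * (1 + k * s) `^ (- b - 1)) by rewrite /f; ring.
  apply: ler_wpM2r; first by rewrite mulr_ge0 ?powR_ge0// (ltW bk0).
  have -> : (t - s) `^ (- al) = (t - s) `^ (1 - al - b) * (t - s) `^ (b - 1).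
    rewrite -powRD; last by rewrite (gt_eqF ts0) implybT.
    by congr (_ `^ _); ring.
  apply: ler_wpM2r; first exact: powR_ge0.
  apply: ge0_ler_powR; rewrite ?nnegrE ?subr_ge0//.
  - exact: ltW.
  - rewrite /Y mulrDl mulrAC divff ?gt_eqF// !mul1r.
    have ki : 0 < k^-1 by rewrite invr_gt0.
    lra.
rewrite RintegralZl//.
apply: (@le_trans _ _ (b * k * Y `^ (1 - al - b) *
    (((t - 0) / (1 + k * 0)) `^ b / (b * (1 + k * t))))).
  by apply: ler_wpM2l => //; rewrite mulr_ge0 ?powR_ge0// ltW.
rewrite subr0 mulr0 addr0 divr1.
have tY : t `^ b <= Y `^ b.
  apply: ge0_ler_powR; rewrite ?nnegrE ?(ltW b0) ?(ltW t0) ?(ltW Y0)//.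
  rewrite /Y mulrDl mulrAC divff ?gt_eqF// !mul1r.
  by rewrite lerDr invr_ge0 ltW.
have -> : b * k * Y `^ (1 - al - b) * (t `^ b / (b * (1 + k * t))) =
   Y `^ (1 - al - b) * t `^ b / Y.
  by rewrite /Y; field; rewrite !gt_eqF.
apply: (@le_trans _ _ (Y `^ (- al))).
  have -> : Y `^ (- al) = Y `^ (1 - al - b) * Y `^ b / Y.
    rewrite -[Y^-1]powR_inv1 ?ltW// -!powRD ?(gt_eqF Y0) ?implybT//.
    by congr (_ `^ _); ring.
  by apply: ler_wpM2r; [rewrite invr_ge0 ltW|apply: ler_wpM2l; rewrite ?powR_ge0].
have -> : Y `^ (- al) = k `^ al * (1 + k * t) `^ (- al).
  rewrite powRN /Y powRM ?invr_ge0 ?ltW// invfM mulrC powRN; congr (_ * _).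
  by rewrite -[k^-1]powR_inv1 ?ltW// -powRrM mulN1r powRN invrK.
apply: ler_wpM2l; first exact: powR_ge0.
by apply: ler_powR; [exact/ks/ltW|rewrite lerN2].
Qed.

(** The point is that the integral converges: otherwise its total value would be
    [0], and so would every Caputo derivative. The integrand is compared with the
    derivative of [(u / (1 + u)) `^ a], a bounded function. *)
Lemma Gamma_gt0 (R : realType) (a : R) : 0 < a -> a <= 1 -> 0 < Gamma a.
Proof.
move=> a0 a1.
pose f (u : R) := u `^ (a - 1) * (1 + u) `^ (- a - 1).
pose F (u : R) := a^-1 * (u / (1 + u)) `^ a.
have dF (u : R) : 0 < u -> is_derive u 1 F (f u).
  move=> u0; have u1 : 0 < 1 + u by rewrite addr_gt0.
  have r0 : 0 < u / (1 + u) by rewrite divr_gt0.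
  have dr : is_derive u 1 (fun u : R => u / (1 + u)) ((1 + u) ^- 2).
    apply: is_derive_eq; first by apply: is_deriveM; apply: is_deriveV; rewrite gt_eqF.
    by rewrite /GRing.scale/=; field; rewrite gt_eqF.
  have := @is_derive_powR_comp _ (fun u => u / (1 + u)) a _ u r0 dr.
  move=> dp; rewrite /F /f.
  have -> : (fun u : R => a^-1 * (u / (1 + u)) `^ a) =
     a^-1 \*: (fun u => (u / (1 + u)) `^ a) by apply/funext.
  apply: is_derive_eq.
  rewrite /GRing.scale/= -powR_ratio//.
  by field; rewrite !gt_eqF.
have f0 (u : R) : 0 <= f u by rewrite mulr_ge0 ?powR_ge0.
pose u (n : nat) : R := n.+1%:R^-1.
pose v (n : nat) : R := n.+1%:R.
have [intf _] : mu.-integrable `]0, +oo[ (EFin \o f) /\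
    \int[mu]_(s in `]0, +oo[) f s <= a^-1.
  apply: (@le_integral_exhaustion R f F _ u v) => //.
  - by move=> n; rewrite /u /v (@le_trans _ _ 1)// ?invf_le1// ler1n.
  - by move=> m n mn; rewrite /u lef_pV2 ?posrE// ler_nat ltnS.
  - by move=> m n mn; rewrite /v ler_nat ltnS.
  - move=> s /=; rewrite in_itv/= andbT => s0.
    exists (maxn (Num.truncn s) (Num.truncn s^-1)) => //=.
    rewrite in_itv/= /u /v; apply/andP; split.
      rewrite -[leRHS]invrK lef_pV2 ?posrE ?invr_gt0//.
      by rewrite (le_trans (ltW (truncnS_gt _)))// ler_nat ltnS leq_maxr.
    by rewrite (le_trans (ltW (truncnS_gt _)))// ler_nat ltnS leq_maxl.
  - move=> n s /andP[us _]; apply: dF.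
    by rewrite (lt_le_trans _ us)// invr_gt0.
  - move=> n s /andP[us _].
    have s0 : 0 < s by rewrite (lt_le_trans _ us)// invr_gt0.
    have s1 : 0 < 1 + s by rewrite addr_gt0.
    apply: (is_derive1_continuous (df := _)); rewrite /f.
    apply: is_deriveM; last first.
      exact: (@is_derive_powR_comp _ (fun s => 1 + s) (- a - 1) _ s s1 _).
    exact: (@is_derive_powR_comp _ id (a - 1) _ s s0 _).
  - move=> n; rewrite /F lerBlDr ler_wpDr//.
      by rewrite mulr_ge0 ?invr_ge0 ?powR_ge0// ltW.
    apply: ler_piMr; first by rewrite invr_ge0 ltW.
    have v0 : 0 < v n by [].
    rewrite [leRHS](_ : 1 = 1 `^ a); last by rewrite powR1.
    have v1 : 0 < 1 + v n by rewrite addr_gt0.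
    apply: ge0_ler_powR; rewrite ?nnegrE ?(ltW a0)//.
      by rewrite divr_ge0 ?ltW.
    by rewrite ler_pdivrMr ?addr_gt0// mul1r lerDr.
pose g (u : R) := u `^ (a - 1) * expR (- u).
have g0 (w : R) : 0 <= g w by rewrite mulr_ge0 ?powR_ge0 ?expR_ge0.
have mg : measurable_fun setT g.
  apply: measurable_funM; first exact: measurable_powR.
  by apply: measurableT_comp => //; exact: measurableT_comp.
have intg : mu.-integrable `]0, +oo[ (EFin \o g).
  have intf4 := @integrableZl _ _ _ mu `]0, +oo[%classic (measurable_itv _) 4 _ intf.
  apply: le_integrable intf4 => //.
    by apply/measurable_EFinP; exact: measurable_funTS.
  move=> w /=; rewrite in_itv/= andbT => w0.
  rewrite lee_fin (ger0_norm (g0 w)) ger0_norm; last by rewrite mulr_ge0.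
  rewrite /g /f mulrCA.
  apply: ler_wpM2l; first exact: powR_ge0.
  have w1 : 1 <= 1 + w by rewrite lerDl ltW.
  have w10 : 0 < 1 + w by rewrite (lt_le_trans ltr01).
  have -> : - a - 1 = - (a + 1) by ring.
  rewrite expRN powRN -[leRHS]invrK lef_pV2 ?posrE ?invr_gt0 ?mulr_gt0 ?invr_gt0 ?powR_gt0 ?expR_gt0//.
  rewrite invfM invrK -ler_pdivlMl ?invr_gt0// invrK.
  apply: (@le_trans _ _ ((1 + w) ^+ 2)).
    by rewrite -powR_mulrn ?(ltW w10)// ler_powR// -lerBrDr; lra.
  have e2 : 1 + w / 2 <= expR (w / 2) by exact: expR_ge1Dx.
  have -> : expR w = expR (w / 2) ^+ 2 by rewrite -expRM_natl; congr expR; field.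
  have -> : 4 * expR (w / 2) ^+ 2 = (2 * expR (w / 2)) ^+ 2 :> R by ring.
  rewrite ler_sqr ?nnegrE ?ltW ?mulr_gt0 ?expR_gt0//; lra.
have lb : ((expR (-1))%:E <= \int[mu]_(w in `]0%R, +oo[) (g w)%:E)%E.
  apply: (@le_trans _ _ (\int[mu]_(w in `]0%R, 1%R]) (expR (-1))%:E)%E).
    by rewrite integral_cst//= lebesgue_measure_itv/= lte_fin ltr01 -EFinB subr0 mule1.
  apply: (@le_trans _ _ (\int[mu]_(w in `]0%R, 1%R]) (g w)%:E)%E).
    apply: ge0_le_integral => //.
    - by apply/measurable_EFinP; exact: measurable_funTS.
    move=> w /=; rewrite in_itv/= => /andP[w0 w1].
    rewrite lee_fin /g -[leLHS]mul1r; apply: ler_pM => //; rewrite ?expR_ge0//.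
      by rewrite -[leLHS](powRr0 w); apply: ger_powR; [rewrite w0 w1|rewrite subr_le0].
    by rewrite ler_expR; lra.
  apply: ge0_subset_integral => //.
  - by apply/measurable_EFinP; exact: measurable_funTS.
  - by move=> w _; rewrite lee_fin.
  - by move=> w /=; rewrite !in_itv/= andbT => /andP[].
rewrite /Gamma -lte_fin fineK; last exact: integrable_fin_num.
by apply: lt_le_trans lb; rewrite lte_fin expR_gt0.
Qed.

(** * The Caputo derivative at a maximum *)

(** Exchange of integrals over the triangle [0 <= r <= s < t]. The weight [w] may
    fail to be integrable up to [t]; only its primitive [W] enters the
    integrability hypothesis. *)
Lemma fubini_triangle (R : realType) (w W g : R -> R) (t : R) :
  measurable_fun `[0, t[ w -> (forall r, 0 <= r < t -> 0 <= w r) ->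
  (forall s, 0 <= s < t -> (\int[mu]_(r in `[0%R, s]) (w r)%:E = (W s)%:E)%E) ->
  mu.-integrable `[0, t[ (EFin \o g) ->
  mu.-integrable `[0, t[ (EFin \o (fun s => W s * g s)) ->
  mu.-integrable `[0, t[ (EFin \o (fun r => w r * \int[mu]_(s in `[r, t[) g s)) /\
  \int[mu]_(s in `[0, t[) (W s * g s) =
    \int[mu]_(r in `[0, t[) (w r * \int[mu]_(s in `[r, t[) g s).
Proof.
move=> mw w0 wW ig iWg.
set D := `[0, t[%classic : set R.
have mD : measurable D by exact: measurable_itv.
have mg : measurable_fun D g by apply/measurable_EFinP; exact: (measurable_int mu).
pose h (z : R * R) : R := if z.1 <= z.2 then (w \_ D) z.1 * (g \_ D) z.2 else 0.
have mh : measurable_fun setT h.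
  apply: measurable_fun_ifT => //.
  - by apply: measurable_fun_ler; [exact: measurable_fst|exact: measurable_snd].
  - apply: measurable_funM.
    + apply: (measurableT_comp (f := w \_ D)); last exact: measurable_fst.
      exact/(measurable_restrictT _ mD).
    + apply: (measurableT_comp (f := g \_ D)); last exact: measurable_snd.
      exact/(measurable_restrictT _ mD).
have DE s : D s = (0 <= s < t) :> Prop by rewrite /D/= in_itv.
have hr s : D s -> (fun r => h (r, s)) = (fun r => g s * w r) \_ `[0, s].
  rewrite DE => /andP[s0 st]; apply/funext => r.
  rewrite /h /= !patchE !mem_setE !in_itv/= s0 st/=.
  have [rs|sr] := leP r s; last by rewrite andbF.
  by rewrite andbT (le_lt_trans rs st) andbT; case: ifP; rewrite ?mul0r// mulrC.
have hr0 s : ~ D s -> (fun r => h (r, s)) = cst 0.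
  move=> Ds; apply/funext => r; rewrite /h/= (patchE g) memNset// mulr0.
  by case: ifP.
have hs r : D r -> (fun s => h (r, s)) = (fun s => w r * g s) \_ `[r, t[.
  rewrite DE => /andP[r0 rt]; apply/funext => s.
  rewrite /h /= !patchE !mem_setE !in_itv/= r0 rt/=.
  have [rs|sr] := leP r s => //.
  by rewrite (le_trans r0 rs)/=; case: ifP; rewrite ?mulr0.
have hs0 r : ~ D r -> (fun s => h (r, s)) = cst 0.
  move=> Dr; apply/funext => s; rewrite /h/= (patchE w) memNset// mul0r.
  by case: ifP.
have sub s : D s -> `[0, s] `<=` D.
  rewrite DE => /andP[_ st] r /=; rewrite /D/= !in_itv/= => /andP[-> /le_lt_trans]; exact.
have subt r : D r -> `[r, t[ `<=` D.
  rewrite DE => /andP[r0 _] s /=; rewrite /D/= !in_itv/= => /andP[/(le_trans r0) -> ->].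
  by [].
have iw s : D s -> mu.-integrable `[0, s] (EFin \o w).
  move=> Ds; apply/integrableP; split.
    by apply/measurable_EFinP; apply: measurable_funS mw => //; exact: sub.
  apply: le_lt_trans (ltry (W s)); rewrite -wW; last by rewrite -DE.
  rewrite le_eqVlt; apply/orP; left; apply/eqP/eq_integral => r.
  by rewrite inE => /(sub _ Ds) Dr /=; rewrite ger0_norm// w0// -DE.
have Fr s : (\int[mu]_r (h (r, s))%:E = ((fun s => W s * g s) \_ D s)%:E)%E.
  rewrite patchE; case: ifPn => [|/negP]; rewrite inE => Ds; last first.
    by rewrite integral0_eq// => r _; rewrite (congr1 (fun f => f r) (hr0 _ Ds)).
  transitivity (\int[mu]_(r in `[0%R, s]) (g s * w r)%:E)%E.
    rewrite [RHS]integral_mkcond; apply: eq_integral => r _.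
    by have := congr1 (fun f => f r) (hr _ Ds); rewrite !patchE => ->; case: ifP.
  under eq_integral do rewrite EFinM.
  rewrite integralZl//; last exact: iw.
  by rewrite wW -?DE// -EFinM mulrC.
have Fs r : (\int[mu]_s (h (r, s))%:E =
    ((fun r => w r * \int[mu]_(s in `[r, t[) g s) \_ D r)%:E)%E.
  rewrite patchE; case: ifPn => [|/negP]; rewrite inE => Dr; last first.
    by rewrite integral0_eq// => s _; rewrite (congr1 (fun f => f s) (hs0 _ Dr)).
  have igr : mu.-integrable `[r, t[ (EFin \o g).
    by apply: integrableS ig => //; exact: subt.
  transitivity (\int[mu]_(s in `[r, t[) (w r * g s)%:E)%E.
    rewrite [RHS]integral_mkcond; apply: eq_integral => s _.
    by have := congr1 (fun f => f s) (hs _ Dr); rewrite !patchE => ->; case: ifP.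
  under eq_integral do rewrite EFinM.
  rewrite integralZl// EFinM /Rintegral fineK//.
  exact: integrable_fin_num.
have Far s : (\int[mu]_r `|(h (r, s))%:E| = ((fun s => `|W s * g s|) \_ D s)%:E)%E.
  rewrite patchE; case: ifPn => [|/negP]; rewrite inE => Ds; last first.
    by rewrite integral0_eq// => r _; rewrite (congr1 (fun f => f r) (hr0 _ Ds))/= normr0.
  transitivity (\int[mu]_(r in `[0%R, s]) (`|g s| * w r)%:E)%E.
    rewrite [RHS]integral_mkcond; apply: eq_integral => r _.
    have := congr1 (fun f => f r) (hr _ Ds); rewrite !patchE => ->.
    case: ifP => [|_]; last by rewrite /= normr0.
    rewrite inE => /(sub _ Ds) Dr; have wr0 : 0 <= w r by rewrite w0// -DE.
    by rewrite /= normrM (ger0_norm wr0).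
  under eq_integral do rewrite EFinM.
  rewrite integralZl//; last exact: iw.
  rewrite wW -?DE// -EFinM normrM mulrC (ger0_norm (_ : 0 <= W s))//.
  rewrite -lee_fin -wW -?DE//; apply: integral_ge0 => r /(sub _ Ds) Dr.
  by rewrite lee_fin w0// -DE.
have mhE : measurable_fun setT (EFin \o h) by exact/measurable_EFinP.
have ih : (mu \x mu)%E.-integrable setT (EFin \o h).
  apply/integrable21ltyP => //=.
  under eq_integral do rewrite Far.
  move: iWg => /integrableP[_]; apply: le_lt_trans.
  rewrite [leRHS]integral_mkcond le_eqVlt; apply/orP; left.
  by apply/eqP/eq_integral => s _; rewrite !patchE; case: ifP.
have iG := integrable_fubini_F ih.
split.
  apply/integrable_mkcond => //.
  apply: eq_integrable iG => // r _.
  by rewrite /fubini_F /= Fs !patchE; case: ifP.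
rewrite [LHS]Rintegral_mkcond [RHS]Rintegral_mkcond /Rintegral; congr fine.
transitivity (\int[mu]_s \int[mu]_r (h (r, s))%:E)%E.
  by apply: eq_integral => s _; rewrite Fr.
transitivity (\int[mu]_r \int[mu]_s (h (r, s))%:E)%E.
  exact: (esym (Fubini ih)).
by apply: eq_integral => r _; rewrite Fs.
Qed.

(** Absolutely continuous functions are handled as pairs of a function and a
    density, so that sums, multiples and barriers can be treated without
    differentiating anything. *)
Definition primitive (R : realType) (T : R) (z g : R -> R) : Prop :=
  mu.-integrable `[0, T] (EFin \o g) /\
  forall r, 0 <= r <= T -> z r = z 0 + \int[mu]_(s in `[0, r]) g s.

Definition abel_integrand (R : realType) (al t : R) (g : R -> R) (s : R) : R :=
  (t - s) `^ (- al) * g s.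

Definition abel_integrable (R : realType) (al t : R) (g : R -> R) : Prop :=
  mu.-integrable `[0, t] (EFin \o abel_integrand al t g).

(** The Caputo derivative of a primitive of [g], without its factor
    [(Gamma (1 - al))^-1]. *)
Definition abel (R : realType) (al t : R) (g : R -> R) : R :=
  \int[mu]_(s in `[0, t]) abel_integrand al t g s.

Lemma integrableD_EFin (R : realType) (D : set R) (f g : R -> R) : measurable D ->
  mu.-integrable D (EFin \o f) -> mu.-integrable D (EFin \o g) ->
  mu.-integrable D (EFin \o (fun s => f s + g s)).
Proof.
move=> mD fi gi.
have : mu.-integrable D ((EFin \o f) \+ (EFin \o g))%E by apply: integrableD.
by apply: eq_integrable => // s _ /=; rewrite EFinD.
Qed.

Lemma integrableZ_EFin (R : realType) (D : set R) (k : R) (f : R -> R) :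
  measurable D -> mu.-integrable D (EFin \o f) ->
  mu.-integrable D (EFin \o (fun s => k * f s)).
Proof.
move=> mD fi.
have : mu.-integrable D (fun s => k%:E * (EFin \o f) s)%E by apply: integrableZl.
by apply: eq_integrable => // s _ /=; rewrite EFinM.
Qed.

Lemma integrableB_EFin (R : realType) (D : set R) (f g : R -> R) : measurable D ->
  mu.-integrable D (EFin \o f) -> mu.-integrable D (EFin \o g) ->
  mu.-integrable D (EFin \o (fun s => f s - g s)).
Proof.
move=> mD fi gi.
have : mu.-integrable D ((EFin \o f) \- (EFin \o g))%E by apply: integrableB.
by apply: eq_integrable => // s _ /=; rewrite EFinB.
Qed.

Lemma le_Rintegral_subset (R : realType) (A D : set R) (f : R -> R) :
  measurable A -> measurable D -> A `<=` D -> (forall x, D x -> 0 <= f x) ->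
  mu.-integrable D (EFin \o f) ->
  \int[mu]_(x in A) f x <= \int[mu]_(x in D) f x.
Proof.
move=> mA mD AD f0 fi; have fA : mu.-integrable A (EFin \o f) by apply: integrableS fi.
rewrite -lee_fin !fineK; [|exact: integrable_fin_num..].
by apply: ge0_subset_integral => //; exact: (measurable_int mu).
Qed.

Section primitive.
Context {R : realType}.
Implicit Types (T t : R) (z g : R -> R).

Lemma primitiveW T t z g : 0 <= t <= T -> primitive T z g -> primitive t z g.
Proof.
move=> /andP[t0 tT] [ig zE]; split.
  by apply: integrableS ig => //; apply: subset_itvl; rewrite bnd_simp.
by move=> r /andP[r0 rt]; apply: zE; rewrite r0 (le_trans rt).
Qed.

Lemma primitiveD T z1 g1 z2 g2 : primitive T z1 g1 -> primitive T z2 g2 ->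
  primitive T (fun s => z1 s + z2 s) (fun s => g1 s + g2 s).
Proof.
move=> p1 p2; split; first exact: (integrableD_EFin _ p1.1 p2.1).
move=> r r0T; have [i1 _] := primitiveW r0T p1; have [i2 _] := primitiveW r0T p2.
by rewrite RintegralD// p1.2// p2.2// addrACA.
Qed.

Lemma primitiveZ T k z g : primitive T z g ->
  primitive T (fun s => k * z s) (fun s => k * g s).
Proof.
move=> p; split; first exact: (integrableZ_EFin _ _ p.1).
move=> r r0T; have [i _] := primitiveW r0T p.
by rewrite RintegralZl// p.2// mulrDr.
Qed.

Lemma abel_integrableD al t g1 g2 :
  abel_integrable al t g1 -> abel_integrable al t g2 ->
  abel_integrable al t (fun s => g1 s + g2 s) /\
  abel al t (fun s => g1 s + g2 s) = abel al t g1 + abel al t g2.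
Proof.
move=> i1 i2.
have E : abel_integrand al t (fun s => g1 s + g2 s) =
    (fun s => abel_integrand al t g1 s + abel_integrand al t g2 s).
  by apply/funext => s; exact: mulrDr.
rewrite /abel_integrable /abel E; split; first exact: integrableD_EFin.
by rewrite RintegralD.
Qed.

Lemma abel_integrableZ al t k g : abel_integrable al t g ->
  abel_integrable al t (fun s => k * g s) /\
  abel al t (fun s => k * g s) = k * abel al t g.
Proof.
move=> i.
have E : abel_integrand al t (fun s => k * g s) =
    (fun s => k * abel_integrand al t g s).
  by apply/funext => s; exact: mulrCA.
rewrite /abel_integrable /abel E; split; first exact: integrableZ_EFin.
by rewrite RintegralZl.
Qed.

Lemma primitive_continuous T z g : 0 <= T -> primitive T z g ->
  {within `[0, T], continuous z}.
Proof.
move=> T0 [ig zE].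
have cG := parameterized_integral_continuous T0 ig.
have cZ : {within `[0, T], continuous (fun r => z 0 + \int[mu]_(s in `[0, r]) g s)}.
  by move=> r; apply: cvgD; [exact: cvg_cst|exact: cG].
apply: subspace_eq_continuous cZ => r; rewrite inE/= in_itv/= => /zE.
exact: esym.
Qed.

Lemma primitive_integrable T z g a b : 0 <= T -> primitive T z g ->
  0 <= a -> b <= T -> mu.-integrable `[a, b] (EFin \o z).
Proof.
move=> T0 pz a0 bT.
apply: continuous_compact_integrable; first exact: segment_compact.
apply: (@continuous_subspaceW _ _ _ `[0, T]).
  by apply: subset_itv; rewrite bnd_simp.
exact: primitive_continuous pz.
Qed.

Lemma integrable_itv_cst (a b k : R) : mu.-integrable `[a, b] (EFin \o (fun=> k)).
Proof. by apply: continuous_itv_integrable => s _; exact: cvg_cst. Qed.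

Lemma primitive_increment T z g r : 0 <= r <= T -> primitive T z g ->
  \int[mu]_(s in `[r, T[) g s = z T - z r.
Proof.
move=> /andP[r0 rT] [ig zE].
have sub : `[r, T] `<=` `[0, T] by apply: subset_itvr; rewrite bnd_simp.
have ir : mu.-integrable `[r, T] (EFin \o g) by apply: integrableS ig.
rewrite Rintegral_itv_bndo_bndc; last first.
  by apply: integrableS ir => //; apply: subset_itvl; rewrite bnd_simp.
rewrite -Rintegral_itv_obnd_cbnd; last first.
  by apply: integrableS ir => //; apply: subset_itvr; rewrite bnd_simp.
rewrite -(Rintegral_itvB ig) ?bnd_simp// (zE r) ?r0// (zE T) ?(le_trans r0 rT) ?lexx//.
ring.
Qed.

(** The Caputo derivative at a maximum is nonnegative, quantitatively: writing
    the kernel as the integral of its own derivative and exchanging the order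
    of integration turns it into a weighted average of the increments
    [z t - z r], all of them nonnegative. *)
Lemma abel_at_max al t z g a b : 0 < al -> 0 < t ->
  primitive t z g -> abel_integrable al t g ->
  (forall r, 0 <= r <= t -> z r <= z t) -> 0 <= a -> a <= b -> b < t ->
  t `^ (- al) * (z t - z 0) +
    al * (t - a) `^ (- al - 1) * \int[mu]_(r in `[a, b]) (z t - z r)
  <= abel al t g.
Proof.
move=> al0 t0 pz ikg zmax a0 ab bt.
have [ig zE] := pz.
pose w r := al * (t - r) `^ (- al - 1).
pose W s := (t - s) `^ (- al) - t `^ (- al).
have sub : `[0, t[ `<=` `[0, t] by apply: subset_itvl; rewrite bnd_simp.
have ig' : mu.-integrable `[0, t[ (EFin \o g) by apply: integrableS ig.
have ikg' : mu.-integrable `[0, t[ (EFin \o abel_integrand al t g).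
  exact: integrableS ikg.
have mw : measurable_fun `[0, t[ w.
  apply: measurable_funTS; apply: measurable_funM => //.
  by apply: (measurableT_comp (measurable_powR _)); exact: measurable_funB.
have dp (r c : R) : r < t ->
    is_derive r 1 (fun r => (t - r) `^ c) (- (c * (t - r) `^ (c - 1))).
  move=> rt; have tr0 : 0 < t - r by rewrite subr_gt0.
  apply: is_derive_eq.
    exact: (@is_derive_powR_comp _ (fun s => t - s) c _ r tr0 _).
  by rewrite add0r; ring.
have wW s : 0 <= s < t -> (\int[mu]_(r in `[0%R, s]) (w r)%:E = (W s)%:E)%E.
  move=> /andP[s0 st].
  have dW r : 0 <= r <= s -> is_derive r 1 (fun r => (t - r) `^ (- al)) (w r).
    move=> /andP[_ rs]; have := dp r (- al) (le_lt_trans rs st).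
    by rewrite mulNr opprK.
  have cw r : 0 <= r <= s -> {for r, continuous w}.
    move=> /andP[_ rs]; rewrite /w; apply: (is_derive1_continuous (df := _)).
    by apply: is_deriveM; apply: dp; exact: le_lt_trans st.
  by rewrite (FTC_derive s0 dW cw) subr0.
have w0 r : 0 <= w r by rewrite mulr_ge0 ?powR_ge0// ltW.
have EW : (fun s => W s * g s) =
   (fun s => abel_integrand al t g s + (- t `^ (- al)) * g s).
  by apply/funext => s; rewrite /W mulrBl mulNr.
have iZ : mu.-integrable `[0, t[ (EFin \o (fun s => - t `^ (- al) * g s)).
  exact: integrableZ_EFin.
have iW : mu.-integrable `[0, t[ (EFin \o (fun s => W s * g s)).
  by rewrite EW; exact: integrableD_EFin.
have [iwG fub] := fubini_triangle mw (fun r _ => w0 r) wW ig' iW.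
have abelE : abel al t g = t `^ (- al) * (z t - z 0) +
    \int[mu]_(r in `[0, t[) (w r * \int[mu]_(s in `[r, t[) g s).
  rewrite -fub EW RintegralD// RintegralZl//.
  rewrite (primitive_increment _ pz) ?lexx ?ltW//.
  rewrite Rintegral_itv_bndo_bndc// -/(abel al t g).
  ring.
rewrite abelE lerD2l.
have Gz r : 0 <= r <= t -> \int[mu]_(s in `[r, t[) g s = z t - z r.
  by move=> rt; exact: primitive_increment.
have subab : `[a, b] `<=` `[0, t[.
  move=> r /=; rewrite !in_itv/= => /andP[ar rb].
  by rewrite (le_trans a0 ar) (le_lt_trans rb).
have iz : mu.-integrable `[a, b] (EFin \o (fun r => z t - z r)).
  apply: integrableB_EFin => //; first exact: integrable_itv_cst.
  by apply: primitive_integrable pz _ _ => //; exact: ltW.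
rewrite -RintegralZl//.
apply: le_trans (le_Rintegral_subset (measurable_itv _) _ subab _ iwG) => //.
  apply: le_Rintegral => //.
  - exact: integrableZ_EFin.
  - exact: integrableS iwG.
  - move=> r abr; have /= := subab _ abr; rewrite in_itv/= => /andP[r0 rt].
    have := abr; rewrite /= in_itv/= => /andP[ar rb].
    rewrite Gz ?r0 ?(ltW rt)//; apply: ler_wpM2r.
      by rewrite subr_ge0 zmax// r0 ltW.
    apply: ler_wpM2l; first exact: ltW.
    have -> : - al - 1 = - (al + 1) by ring.
    rewrite !powRN lef_pV2 ?posrE ?powR_gt0 ?subr_gt0//; last exact: le_lt_trans rt.
    apply: ge0_ler_powR; rewrite ?nnegrE ?subr_ge0.
    - by rewrite addr_ge0// ltW.
    - exact: ltW.
    - exact: le_trans ar (ltW rt).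
    - by rewrite lerD2l lerN2.
move=> r /=; rewrite in_itv/= => /andP[r0 rt].
by rewrite Gz ?r0 ?(ltW rt)// mulr_ge0// subr_ge0 zmax// r0 ltW.
Qed.

End primitive.

(** * Slow barriers and ramps *)

Definition decay (R : realType) (K k b t : R) : R := K * (1 + k * t) `^ (- b).

(** The derivative of [decay K k b]. *)
Definition decay' (R : realType) (K k b t : R) : R :=
  - K * (b * k * (1 + k * t) `^ (- b - 1)).

(** A positive nonincreasing function that starts at [K] and varies by a factor
    at most [1 + eta] over a time [L], which will be a few delays. *)
Definition slow_barrier (R : realType) (eta L K : R) (B : R -> R) : Prop :=
  [/\ B 0 = K,
      forall t, 0 <= t -> 0 < B t,
      forall s t, 0 <= s <= t -> B t <= B s &
      forall s t, 0 <= s -> s <= t <= s + L -> B s <= (1 + eta) * B t].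

Section decay.
Context {R : realType}.
Variables (K k b : R).
Hypotheses (K0 : 0 < K) (k0 : 0 < k) (b0 : 0 < b) (b1 : b <= 1).

Let pos t : 0 <= t -> 1 <= 1 + k * t.
Proof. by move=> t0; rewrite lerDl mulr_ge0// ltW. Qed.

Let pos0 t : 0 <= t -> 0 < 1 + k * t.
Proof. by move=> t0; rewrite (lt_le_trans ltr01)// pos. Qed.

Lemma decay_slow (eta L : R) : k * L <= eta -> slow_barrier eta L K (decay K k b).
Proof.
move=> kL; split.
- by rewrite /decay mulr0 addr0 powR1 mulr1.
- by move=> t t0; rewrite mulr_gt0// powR_gt0// pos0.
- move=> s t /andP[s0 st]; rewrite /decay ler_pM2l// !powRN lef_pV2 ?posrE.
  + apply: ge0_ler_powR; rewrite ?nnegrE.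
    * exact: ltW.
    * exact/ltW/pos0.
    * exact/ltW/pos0/(le_trans s0).
    * by rewrite lerD2l ler_pM2l.
  + by rewrite powR_gt0// pos0// (le_trans s0).
  + by rewrite powR_gt0// pos0.
- move=> s t s0 /andP[st tL]; rewrite /decay mulrCA ler_pM2l//.
  have t0 := le_trans s0 st.
  have sb : 0 < (1 + k * s) `^ b by rewrite powR_gt0// pos0.
  have tb : 0 < (1 + k * t) `^ b by rewrite powR_gt0// pos0.
  rewrite !powRN ler_pdivlMr// mulrC ler_pdivrMr//.
  have e0 : 0 <= eta.
    by rewrite (le_trans _ kL)// mulr_ge0 ?(ltW k0)//; lra.
  apply: (@le_trans _ _ (((1 + eta) * (1 + k * s)) `^ b)).
    apply: ge0_ler_powR; rewrite ?nnegrE.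
    + exact: ltW.
    + exact/ltW/pos0.
    + by apply: mulr_ge0; [exact: addr_ge0|exact/ltW/pos0].
    + have : k * t <= k * s + k * L by rewrite -mulrDr ler_pM2l.
      have : 0 <= eta * (k * s) by rewrite !mulr_ge0// ltW.
      rewrite mulrDl mul1r mulrDr mulr1; lra.
  rewrite powRM; [|exact: addr_ge0|exact/ltW/pos0].
  apply: ler_wpM2r; first exact: ltW.
  by rewrite ler1_powR// lerDl.
Qed.

Lemma is_derive_decay (t : R) : 0 <= t ->
  is_derive t 1 (decay K k b) (decay' K k b t).
Proof.
move=> t0.
have dp := @is_derive_powR_comp _ (fun s => 1 + k * s) (- b) _ t (pos0 t0) _.
have -> : decay K k b = K \*: (fun s => (1 + k * s) `^ (- b)) by apply/funext.
apply: is_derive_eq.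
rewrite /decay' /GRing.scale/= ?mulr0 ?add0r ?addr0 ?mulr1. ring.
Qed.

Lemma decay'_continuous (t : R) : 0 <= t -> {for t, continuous (decay' K k b)}.
Proof.
move=> t0.
have -> : decay' K k b = (fun s => (- K * (b * k)) * (1 + k * s) `^ (- b - 1)).
  by apply/funext => s; rewrite /decay' !mulrA.
have dp := @is_derive_powR_comp _ (fun s => 1 + k * s) (- b - 1) _ t (pos0 t0) _.
by apply: cvgM; [exact: cvg_cst|exact: is_derive1_continuous (dp _ _)].
Qed.

Lemma decay_primitive (T : R) : primitive T (decay K k b) (decay' K k b).
Proof.
split.
  by apply: continuous_itv_integrable => t /andP[t0 _]; exact: decay'_continuous.
move=> r /andP[r0 _].
have dF t : 0 <= t <= r -> is_derive t 1 (decay K k b) (decay' K k b t).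
  by move=> /andP[t0 _]; exact: is_derive_decay.
have cf t : 0 <= t <= r -> {for t, continuous (decay' K k b)}.
  by move=> /andP[t0 _]; exact: decay'_continuous.
by rewrite /Rintegral (FTC_derive r0 dF cf)/= addrC subrK.
Qed.

Lemma decay'_ge (t : R) : 0 <= t -> - (k * decay K k b t) <= decay' K k b t.
Proof.
move=> t0; rewrite /decay' /decay mulNr lerN2.
have -> : - b - 1 = - (1 + b) by ring.
have p0 := pos0 t0; have p1 := pos t0.
have X0 := powR_gt0 (- b) p0.
have le : (1 + k * t) `^ (- (1 + b)) <= (1 + k * t) `^ (- b).
  by apply: ler_powR => //; rewrite lerN2 lerDr.
have -> : K * (b * k * (1 + k * t) `^ (- (1 + b))) =
    (k * K) * (b * (1 + k * t) `^ (- (1 + b))) by ring.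
rewrite [leRHS]mulrA ler_pM2l ?mulr_gt0//.
have -> : (1 + k * t) `^ (- b) = 1 * (1 + k * t) `^ (- b) by rewrite mul1r.
by apply: ler_pM; rewrite ?powR_ge0// ltW.
Qed.

Lemma decay_cvg0 : decay K k b t @[t --> +oo] --> 0.
Proof.
apply/cvgrPdist_lt => e e0; near=> t.
have t0 : 0 <= t by near: t; exact: nbhs_pinfty_ge.
rewrite sub0r normrN ger0_norm; last by rewrite mulr_ge0 ?powR_ge0// ltW.
have p0 := pos0 t0.
rewrite /decay powRN ltr_pdivrMr ?powR_gt0// -ltr_pdivrMl//.
have Ke : 0 < e^-1 * K by rewrite mulr_gt0 ?invr_gt0.
rewrite [ltLHS](_ : _ = ((e^-1 * K) `^ b^-1) `^ b); last first.
  by rewrite -powRrM mulVf ?gt_eqF// powRr1// ltW.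
apply: gt0_ltr_powR => //; rewrite ?nnegrE ?powR_ge0 ?(ltW p0)//.
apply: (@lt_trans _ _ (k * t)); last by rewrite ltrDr.
rewrite -ltr_pdivrMl//.
by near: t; apply: nbhs_pinfty_gt; exact: num_real.
Unshelve. all: by end_near. Qed.

Lemma decay'_abel (al t : R) : 0 < al -> b <= al -> b <= 1 - al -> 0 < t ->
  abel_integrable al t (decay' K k b) /\
  - (k `^ al * decay K k b t) <= abel al t (decay' K k b).
Proof.
move=> al0 bal bal1 t0.
have al1 : al < 1 by rewrite -subr_gt0 (lt_le_trans b0).
pose g (s : R) := b * k * (1 + k * s) `^ (- b - 1).
have ig : abel_integrable al t g.
  apply: (@integrable_abel_bounded _ _ _ _ (b * k)) => //.
    apply: measurable_funTS; apply: measurable_funM => //.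
    apply: (measurableT_comp (measurable_powR _)).
    by apply: measurable_funD => //; apply: measurable_funM.
  move=> s /andP[s0 st].
  have bk0 : 0 <= b * k by rewrite mulr_ge0// ltW.
  rewrite ger0_norm; last by rewrite mulr_ge0 ?powR_ge0.
  apply: ler_piMr => //.
  have -> : - b - 1 = - (b + 1) by ring.
  rewrite powRN invf_le1 ?powR_gt0 ?pos0//.
  rewrite -[leLHS](powRr0 (1 + k * s)); apply: ler_powR; first exact: pos.
  by rewrite addr_ge0// ltW.
have [ig' ->] := abel_integrableZ (- K) ig; split => //.
rewrite /decay mulrCA mulNr lerN2 ler_pM2l//.
exact: caputo_decay_bound.
Qed.

End decay.

Section ramp.
Context {R : realType}.

Definition ramp (e r : R) : R := Num.max 0 (r - e).

Lemma ramp_primitive (e T : R) : 0 <= e -> primitive T (ramp e) \1_(`[e, +oo[).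
Proof.
move=> e0.
have iI r : mu.-integrable `[0, r] (EFin \o (\1_(`[e, +oo[) : R -> R)).
  apply: measurable_bounded_integrable => //.
  - by rewrite /= lebesgue_measure_itv/=; case: ifP => _; rewrite ?ltry.
  - exists 1; split; first exact: num_real.
    move=> x x1 s _; rewrite /= ger0_norm// (le_trans _ (ltW x1))// indicE lern1 leq_b1.
split => // r /andP[r0 _].
rewrite {2}/ramp sub0r max_l ?oppr_le0// add0r.
rewrite /Rintegral integral_indic//.
have -> : `[e, +oo[ `&` `[0, r] = `[e, r]%classic.
  apply/seteqP; split => s /=; rewrite !in_itv/= andbT.
    by move=> [es /andP[_ sr]]; rewrite es.
  by move=> /andP[es sr]; rewrite es sr (le_trans e0 es).
rewrite /= lebesgue_measure_itv/= lte_fin /ramp.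
case: ltP => er.
  by rewrite max_r ?subr_ge0 ?ltW.
by rewrite max_l// subr_le0.
Qed.

Lemma ramp_abel (al e t : R) : al < 1 -> 0 <= e -> e < t ->
  abel_integrable al t \1_(`[e, +oo[) /\
  abel al t \1_(`[e, +oo[) <= (t - e) `^ (1 - al) / (1 - al).
Proof.
move=> al1 e0 et; split.
  apply: (@integrable_abel_bounded _ _ _ _ 1) => //.
  - exact: le_lt_trans et.
  - by move=> s _; rewrite ger0_norm// indicE lern1 leq_b1.
have [_] := abel_kernel_integral al1 e0 et.
apply: le_trans; rewrite le_eqVlt; apply/orP; left; apply/eqP.
rewrite /abel /abel_integrand.
have -> : `[e, t]%classic = `[0, t] `&` `[e, +oo[ :> set R.
  apply/seteqP; split => s /=; rewrite !in_itv/= andbT.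
    by move=> /andP[es st]; rewrite es st (le_trans e0 es).
  by move=> [/andP[_ st] es]; rewrite es.
rewrite Rintegral_mkcondr; apply: eq_Rintegral => s _.
by rewrite patchE indicE; case: ifP => _; rewrite ?mulr1 ?mulr0.
Qed.

End ramp.

(** * Functions with bounded Caputo derivative *)

(** A lower bound on the Caputo derivative forbids sudden drops: if [y >= 0] has
    mean almost [2 * M] or more just before each point of the window
    [r0 - h <= r <= r0], then it cannot be below [M / 2] at [r0]. Indeed, add to
    [- y] the ramp that grows from [0] to [M] over the window. If [y r0 <= M / 2],
    the maximum [r1] of the sum lies in the window, and there the singularity of
    the kernel makes the Caputo derivative of the sum at least of order
    [nu `^ (- al) * M], which for small [nu] exceeds what the lower bound on the
    derivative of [y] and the explicit derivative of the ramp allow. *)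
Lemma no_sudden_drop (R : realType) (al h nu r0 M X : R) (y g : R -> R) :
  0 < al -> al < 1 -> 0 < nu -> nu <= h -> 2 * h <= r0 -> 0 < M ->
  X + h `^ (- al) / (1 - al) < al * nu `^ (- al) / 2 ->
  primitive r0 y g -> (forall r, 0 <= r <= r0 -> 0 <= y r) ->
  (forall r, 0 < r <= r0 -> abel_integrable al r g) ->
  (forall r, r0 - h <= r <= r0 -> - X * M <= abel al r g) ->
  (forall r, r0 - h <= r <= r0 ->
    \int[mu]_(s in `[r - nu, r - nu / 2]) (2 * M - y s) <= nu / 4 * M) ->
  M / 2 < y r0.
Proof.
move=> al0 al1 nu0 nuh hr0 M0 HX py y0 iy gy meany; rewrite ltNge; apply/negP => yr0.
have h0 : 0 < h by rewrite (lt_le_trans nu0).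
have r00 : 0 < r0 by lra.
pose e := r0 - h.
have e0 : 0 < e by rewrite /e; lra.
pose z r := - 1 * y r + M / h * ramp e r.
pose gz r := - 1 * g r + M / h * \1_(`[e, +oo[) r.
have pz : primitive r0 z gz.
  by apply: primitiveD; apply: primitiveZ => //; exact/ramp_primitive/ltW.
have [r1 + zr1] := EVT_max (ltW r00) (primitive_continuous (ltW r00) pz).
rewrite in_itv/= => /andP[r10 r1r0].
have Mh0 : 0 < M / h by rewrite divr_gt0.
have zr r : 0 <= r <= r0 -> z r <= - y r + M.
  move=> /andP[r_0 rr0]; rewrite /z mulN1r lerD2l.
  apply: (@le_trans _ _ (M / h * h)); last by rewrite divfK// gt_eqF.
  rewrite ler_pM2l// /ramp ge_max (ltW h0)/=.
  by rewrite /e; lra.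
have zr0 : M / 2 <= z r0.
  rewrite /z mulN1r /ramp max_r; last by rewrite /e; lra.
  have -> : M / h * (r0 - e) = M by rewrite /e; field; rewrite gt_eqF.
  by lra.
have z1 : M / 2 <= z r1.
  by apply: le_trans zr0 (zr1 _ _); rewrite in_itv/= lexx ltW.
have er1 : e < r1.
  rewrite ltNge; apply/negP => r1e.
  have : z r1 <= 0.
    rewrite /z /ramp max_l; last by rewrite subr_le0.
    by rewrite mulr0 addr0 mulN1r oppr_le0 y0// r10.
  lra.
have r1p : 0 < r1 by rewrite (lt_trans e0).
have r1i : 0 < r1 <= r0 by rewrite r1p.
have [iy1 ay1] := abel_integrableZ (- 1) (iy _ r1i).
have [ir ar] := ramp_abel al1 (ltW e0) er1.
have [ir1 ar1] := abel_integrableZ (M / h) ir.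
have [iz az] := abel_integrableD iy1 ir1.
have gz_le : abel al r1 gz <= (X + h `^ (- al) / (1 - al)) * M.
  rewrite az ay1 ar1 mulN1r mulrDl; apply: lerD.
    by rewrite lerNl -mulNr gy// (ltW er1).
  have -> : h `^ (- al) / (1 - al) * M = M / h * (h `^ (1 - al) / (1 - al)).
    have -> : h `^ (1 - al) = h * h `^ (- al).
      by rewrite powRD ?powRr1 ?(ltW h0)// (gt_eqF h0) implybT.
    by field; rewrite !gt_eqF// subr_gt0.
  rewrite ler_pM2l//; apply: (le_trans ar).
  rewrite ler_pM2r ?invr_gt0 ?subr_gt0//.
  apply: ge0_ler_powR; rewrite ?nnegrE ?subr_ge0 ?(ltW al1) ?(ltW er1) ?(ltW h0)//.
  by rewrite /e; lra.
have a0 : 0 <= r1 - nu by rewrite /e in er1; lra.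
have ab : r1 - nu <= r1 - nu / 2 by lra.
have bt : r1 - nu / 2 < r1 by rewrite ltrBlDr ltrDl divr_gt0.
have pz1 : primitive r1 z gz by apply: primitiveW pz; rewrite r10.
have zmax r : 0 <= r <= r1 -> z r <= z r1.
  by move=> /andP[r_0 rr1]; apply: zr1; rewrite in_itv/= r_0 (le_trans rr1).
have := abel_at_max al0 r1p pz1 iz zmax a0 ab bt.
rewrite leNgt => /negP; apply.
apply: le_lt_trans gz_le _.
have z10 : 0 <= r1 `^ (- al) * (z r1 - z 0).
  by rewrite mulr_ge0 ?powR_ge0// subr_ge0 zmax// lexx ltW.
apply: lt_le_trans (ler_wpDl z10 (lexx _)).
have -> : r1 - (r1 - nu) = nu by ring.
(* on this interval [z <= - y + M], hence
   [z r1 - z >= M / 2 - M + y = 3 * M / 2 - (2 * M - y)] *)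
have J0 : nu / 2 * M <= \int[mu]_(r in `[r1 - nu, r1 - nu / 2]) (z r1 - z r).
  have iyJ : mu.-integrable `[r1 - nu, r1 - nu / 2] (EFin \o (fun r => 2 * M - y r)).
    apply: integrableB_EFin => //; first exact: integrable_itv_cst.
    by apply: primitive_integrable py _ _ => //; lra.
  have iJ : mu.-integrable `[r1 - nu, r1 - nu / 2]
      (EFin \o (fun r => 3 * M / 2 - (2 * M - y r))).
    by apply: integrableB_EFin => //; exact: integrable_itv_cst.
  apply: (@le_trans _ _
    (\int[mu]_(r in `[r1 - nu, r1 - nu / 2]) (3 * M / 2 - (2 * M - y r)))).
    rewrite RintegralB//; last exact: integrable_itv_cst.
    have -> : \int[mu]_(r in `[r1 - nu, r1 - nu / 2]) (3 * M / 2) = 3 * M / 2 * (nu / 2).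
      rewrite Rintegral_cst//= lebesgue_measure_itv/= lte_fin ltrD2l ltrN2.
      rewrite ltr_pdivrMr// ltr_pMr// ltr1n/=; congr (_ * _); lra.
    have := meany r1; rewrite (ltW er1) r1r0 => /(_ isT); lra.
  apply: le_Rintegral => //.
    apply: integrableB_EFin => //; first exact: integrable_itv_cst.
    by apply: primitive_integrable pz1 _ _ => //; rewrite ltW.
  move=> r /=; rewrite in_itv/= => /andP[ra rb].
  have /zr : 0 <= r <= r0.
    by rewrite (le_trans a0 ra)/= (le_trans rb)// (le_trans (ltW bt)).
  lra.
apply: lt_le_trans (ler_wpM2l _ J0); last by rewrite mulr_ge0 ?powR_ge0// ltW.
have -> : nu `^ (- al - 1) = nu `^ (- al) / nu.
  by rewrite powRB ?(gt_eqF nu0) ?implybT// powRr1// ltW.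
have -> : al * (nu `^ (- al) / nu) * (nu / 2 * M) = al * nu `^ (- al) / 2 * M.
  by field; rewrite gt_eqF.
by rewrite ltr_pM2r.
Qed.

(** * Contact with a barrier *)

(** How much the instantaneous term [- a * x] outweighs the delayed term
    [delta * x(t - tau)] when that is possible, that is for [delta >= 0]; for
    negative [delta], which may balance [a] exactly, the size of [delta]. It is
    the scale below which perturbations are harmless. *)
Definition delay_margin (R : realType) (a delta : R) : R :=
  if 0 <= delta then a - delta else - delta.

Lemma delay_margin_gt0 (R : realType) (a delta : R) :
  delta < a -> 0 < delay_margin a delta.
Proof.
by move=> ad; rewrite /delay_margin; have [d0|d0] := leP 0 delta; lra.
Qed.

(** What the equation says at a point where the solution equals [K], dominates
    the recent past up to a factor [1 + eta], and has a derivative that is not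
    markedly negative: the delayed value [v] must be close to [- K]. Here [F] is
    the right-hand side and [c * eta * K] the error in the sign of the derivative.
    For [delta >= 0] the instantaneous term wins, a contradiction. *)
Lemma contact_delayed (R : realType) (a delta C c eta K v F : R) :
  - a <= delta -> delta < a -> 0 < K -> 0 <= eta ->
  eta * (`|delta| + 4 * C + c) < delay_margin a delta ->
  `|v| <= (1 + eta) * K ->
  `|F - (delta * v - a * K)| <= 4 * C * eta * K ->
  0 <= F + c * eta * K ->
  [/\ delta < 0,
    delay_margin a delta * v <=
      (eta * (`|delta| + 4 * C + c) - delay_margin a delta) * K &
    F + c * eta * K <= eta * (`|delta| + 4 * C + c) * K].
Proof.
rewrite /delay_margin => da ad K0 e0 + vK FK F0.
have := vK; rewrite ler_norml => /andP[v1 v2].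
have := FK; rewrite ler_norml => /andP[F1 F2].
have [d0|d0] := leP 0 delta.
  rewrite ger0_norm// => eD; exfalso.
  have : delta * v <= delta * ((1 + eta) * K) by exact: ler_wpM2l.
  have : 0 < (a - delta - eta * (delta + 4 * C + c)) * K by rewrite mulr_gt0// subr_gt0.
  lra.
rewrite ltr0_norm// => eD.
have : - delta * - v <= - delta * ((1 + eta) * K) by apply: ler_wpM2l; lra.
have : - delta * K <= a * K by rewrite ler_pM2r//; lra.
have : 0 <= - delta * (eta * K) by rewrite !mulr_ge0// ?oppr_ge0 ltW.
by split => //; lra.
Qed.

Lemma rhs_at_contact (R : realType) (f : R -> R -> R) (a delta C eta K u v : R) :
  (forall m u v, m <= 1 -> `|u| <= m -> `|v| <= m ->
    `|f u v - (delta * v - a * u)| <= C * m ^+ 2) ->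
  0 <= C -> 0 <= eta -> eta <= 2^-1 -> 0 < K -> K <= eta ->
  `|u| <= (1 + eta) * K -> `|v| <= (1 + eta) * K ->
  `|f u v - (delta * v - a * u)| <= 4 * C * eta * K.
Proof.
move=> Hf C0 e0 e1 K0 Ke uK vK.
have K2 : (1 + eta) * K <= 2 * K by rewrite ler_pM2r//; lra.
apply: le_trans (Hf (2 * K) _ _ _ (le_trans uK K2) (le_trans vK K2)) _; first lra.
have -> : C * (2 * K) ^+ 2 = 4 * C * (K * K) by ring.
rewrite -!mulrA !ler_wpM2l//.
by rewrite ler_pM2r.
Qed.

(** The window of three delays that precedes contact may reach into the history,
    where the bound [K0 / 2] takes over. *)
Lemma slow_barrier_window (R : realType) (eta tau K0 t0 s : R) (B x : R -> R) :
  0 <= t0 -> slow_barrier eta (3 * tau) K0 B ->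
  (forall s, - tau <= s <= 0 -> `|x s| <= K0 / 2) ->
  (forall s, 0 <= s <= t0 -> `|x s| <= B s) ->
  - tau <= s -> t0 - 3 * tau <= s -> s <= t0 -> `|x s| <= (1 + eta) * B t0.
Proof.
move=> t00 [B0 Bpos _ Bslow] xhist xB s1 s2 s3; have [s0|s0] := leP 0 s.
  apply: le_trans (xB s _) _; first by rewrite s0.
  by apply: Bslow => //; rewrite s3/=; clear -s2; lra.
apply: le_trans (xhist s _) _; first by rewrite s1 ltW.
have K0_le : K0 <= (1 + eta) * B t0.
  by rewrite -B0; apply: Bslow => //; rewrite t00/=; clear -s2 s0; lra.
have K0_gt0 : 0 < K0 by rewrite -B0; exact: Bpos.
by clear -K0_le K0_gt0; lra.
Qed.

(** The case [al < 1] of the main argument. At a first contact of [x] with the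
    barrier, [abel_at_max] for [x - B] yields three bounds of size [eta * B t0]:
    on the gap [B 0 - x 0], which excludes contact before [2 * tau]; on the mean of
    [B - x] over the past; and, by [contact_delayed], on the distance between
    [x (t0 - tau)] and [- B t0]. The last two contradict [no_sudden_drop] for
    [y := x + B], on a window of half a delay that ends at [t0 - tau]. *)
Lemma frac_no_contact (R : realType) (al c a delta tau C : R) (f : R -> R -> R) :
  0 < al -> al < 1 -> 0 < c -> - a <= delta -> delta < a -> 0 <= tau -> 0 <= C ->
  (forall m u v, m <= 1 -> `|u| <= m -> `|v| <= m ->
    `|f u v - (delta * v - a * u)| <= C * m ^+ 2) ->
  exists2 eta0 : R, 0 < eta0 &
  forall (eta K0 t0 : R) (B B' x g : R -> R),
  0 < eta -> eta <= eta0 -> K0 <= eta -> 0 < t0 ->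
  slow_barrier eta (3 * tau) K0 B -> primitive t0 B B' ->
  (forall t, 0 < t <= t0 ->
    abel_integrable al t B' /\ - (eta * B t) <= abel al t B') ->
  primitive t0 x g ->
  (forall t, 0 < t <= t0 ->
    abel_integrable al t g /\ c * abel al t g = f (x t) (x (t - tau))) ->
  (forall s, - tau <= s <= 0 -> `|x s| <= K0 / 2) ->
  (forall s, 0 <= s <= t0 -> `|x s| <= B s) ->
  x t0 <> B t0.
Proof.
move=> al0 al1 c0 da ad tau0 C0 Hf.
have D0 := delay_margin_gt0 ad.
set D := delay_margin a delta in D0 *.
pose E := `|delta| + 4 * C + c.
have E0 : 0 < E by rewrite ltr_pwDr// addr_ge0// mulr_ge0.
pose Q := 1 + E / D.
have Q0 : 0 < Q by rewrite addr_gt0// divr_gt0.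
pose h := tau / 2.
pose X := (2 * `|a| + 2 * `|delta| + 4 * C) / c + 1.
pose Y := 2 * (X + h `^ (- al) / (1 - al)) / al + 1.
have Y0 : 0 < Y.
  rewrite ltr_wpDl// divr_ge0 ?(ltW al0)// mulr_ge0// !addr_ge0// ?divr_ge0 ?(ltW c0) ?powR_ge0 ?subr_ge0 ?(ltW al1)//.
  by rewrite !addr_ge0// mulr_ge0.
(* [nu] is the distance at which [no_sudden_drop] looks into the past; the
   smallness conditions on [eta0] are, in this order, those of [rhs_at_contact],
   of [contact_delayed], of contact before [2 * tau] and of the mean of [B - x] *)
pose nu := Num.min h (Y `^ (- al^-1)).
pose eta0 := Num.min (Num.min 2^-1 (2 * Q)^-1)
  (Num.min (if tau == 0 then 1 else c * (2 * tau) `^ (- al) / (4 * E))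
     (if tau == 0 then 1 else nu / 4 * (c * al * (2 * tau) `^ (- al - 1)) / E)).
have nu0 : 0 < tau -> 0 < nu.
  by move=> t0; rewrite lt_min powR_gt0// divr_gt0.
exists eta0.
  rewrite !lt_min invr_gt0 ltr0n/= invr_gt0 mulr_gt0//=.
  have [tz|tn0] := eqVneq tau 0; first by rewrite !ltr01.
  have tp : 0 < tau by rewrite lt_neqAle eq_sym tn0.
  have t2 : 0 < 2 * tau by rewrite mulr_gt0.
  by rewrite !(divr_gt0, mulr_gt0, powR_gt0)//= nu0.
move=> eta K0 t0 B B' x g eta_gt0 + K0eta t00 slow pB aB px xeq xhist xB xt0.
rewrite !le_min => /andP[/andP[e12 eQ] /andP[eE eN]].
have [B0 Bpos Bdec Bslow] := slow.
set K := B t0 in xt0.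
have Kpos : 0 < K by exact/Bpos/ltW.
have K0K : K <= K0 by rewrite -B0; apply: Bdec; rewrite lexx ltW.
have eE1 : eta * E < D.
  have : eta * Q <= 2^-1.
    by rewrite (le_trans (ler_wpM2r (ltW Q0) eQ))// invfM -mulrA mulVf ?gt_eqF// mulr1.
  rewrite /Q mulrDr mulr1 => eQ'.
  have : eta * (E / D) < 1 by clear -eQ' eta_gt0; lra.
  by rewrite mulrA ltr_pdivrMr// mul1r.
have xlate s : - tau <= s -> t0 - 3 * tau <= s -> s <= t0 -> `|x s| <= (1 + eta) * K.
  exact: slow_barrier_window (ltW t00) slow xhist xB.
have rhsb t : 0 < t <= t0 -> t0 - 2 * tau <= t ->
    `|c * abel al t g - (delta * x (t - tau) - a * x t)| <= 4 * C * eta * K.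
  move=> /andP[tp tt0] t2; rewrite (xeq t _).2 ?tp//.
  apply: rhs_at_contact => //; first exact: ltW.
  - exact: le_trans K0K K0eta.
  - by apply: xlate; clear -tau0 t2 tp tt0; lra.
  - by apply: xlate; clear -tau0 t2 tp tt0; lra.
have t0t0 : 0 < t0 <= t0 by rewrite t00 lexx.
have pz : primitive t0 (fun s => x s + (- 1) * B s) (fun s => g s + (- 1) * B' s).
  by apply: primitiveD px _; exact: primitiveZ.
have [iz1 zB1] := abel_integrableZ (- 1) (aB _ t0t0).1.
have [iz abz] := abel_integrableD (xeq _ t0t0).1 iz1.
have zmax r : 0 <= r <= t0 -> x r + (- 1) * B r <= x t0 + (- 1) * B t0.
  move=> rt; rewrite xt0 !mulN1r subrr subr_le0.
  exact: le_trans (ler_norm _) (xB _ rt).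
have zK : x t0 + (- 1) * B t0 = 0 by rewrite xt0 mulN1r subrr.
have absz : c * abel al t0 (fun s => g s + (- 1) * B' s) <= c * abel al t0 g + c * eta * K.
  rewrite abz zB1 mulrDr lerD2l -mulrA ler_pM2l// mulN1r lerNl.
  exact: (aB _ t0t0).2.
have zge (u v : R) : 0 <= u -> u <= v -> v < t0 ->
  t0 `^ (- al) * (B 0 - x 0) +
    al * (t0 - u) `^ (- al - 1) * \int[mu]_(r in `[u, v]) (B r - x r) <=
  abel al t0 (fun s => g s + (- 1) * B' s).
  move=> u0 uv vt; apply: le_trans (abel_at_max al0 t00 pz iz zmax u0 uv vt).
  have -> : x t0 + -1 * B t0 - (x 0 + -1 * B 0) = B 0 - x 0.
    by rewrite zK mulN1r sub0r opprB.
  rewrite lerD2l; apply: ler_wpM2l; first by rewrite mulr_ge0 ?powR_ge0// ltW.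
  rewrite le_eqVlt; apply/orP; left; apply/eqP/eq_Rintegral => r _.
  by rewrite zK mulN1r sub0r opprB.
have u0 r : 0 <= r <= t0 -> 0 <= B r - x r.
  by move=> rt; rewrite subr_ge0 (le_trans (ler_norm _))// xB.
have abz0 : 0 <= abel al t0 (fun s => g s + -1 * B' s).
  apply: le_trans (zge 0 0 (lexx _) (lexx _) t00).
  rewrite addr_ge0// mulr_ge0 ?powR_ge0//.
  - by apply: u0; rewrite lexx ltW.
  - by rewrite mulr_ge0 ?powR_ge0// ltW.
  - apply: Rintegral_ge0 => r /=; rewrite in_itv/= => /andP[r0 r1].
    by apply: u0; rewrite r0 (le_trans r1) ?ltW.
have vK : `|x (t0 - tau)| <= (1 + eta) * K.
  by apply: xlate; clear -tau0 t00; lra.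
have t02 : t0 - 2 * tau <= t0 by clear -tau0; lra.
have FK := rhsb t0 t0t0 t02.
rewrite xt0 in FK.
have F0 : 0 <= c * abel al t0 g + c * eta * K.
  by apply: le_trans absz; rewrite mulr_ge0// ltW.
have [dn vD FE] := contact_delayed da ad Kpos (ltW eta_gt0) eE1 vK FK F0.
rewrite -/E -/D in vD FE.
have zE : abel al t0 (fun s => g s + -1 * B' s) <= eta * E * K / c.
  by rewrite ler_pdivlMr// mulrC (le_trans absz).
(* without delay, [x t0] would be close to both [K] and [- K] *)
have [tz|tn0] := eqVneq tau 0.
  rewrite tz subr0 xt0 in vD.
  have : (eta * E - D) * K < 0 by rewrite nmulr_rlt0// subr_lt0.
  have : 0 < D * K by rewrite mulr_gt0.
  by clear -vD; lra.
rewrite (negbTE tn0) in eE eN.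
have tp : 0 < tau by rewrite lt_neqAle eq_sym tn0.
have tau2 : 0 < 2 * tau by rewrite mulr_gt0.
(* early contact: the gap [B 0 - x 0 >= K0 / 2] is too wide *)
have [t2|t2] := ltP t0 (2 * tau).
  have x0K : `|x 0| <= K0 / 2 by apply: xhist; rewrite lexx oppr_le0 ltW.
  have K00 : 0 < K0 by rewrite (lt_le_trans Kpos).
  have Bx0 : K0 / 2 <= B 0 - x 0.
    by move: x0K; rewrite ler_norml B0 => /andP[_]; clear; lra.
  have p2 : 0 < (2 * tau) `^ (- al) by rewrite powR_gt0.
  have tt : (2 * tau) `^ (- al) <= t0 `^ (- al).
    rewrite !powRN lef_pV2 ?posrE ?powR_gt0//.
    by apply: ge0_ler_powR; rewrite ?nnegrE ltW.
  have H1 : (2 * tau) `^ (- al) * (K0 / 2) <= eta * E * K / c.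
    apply: le_trans zE; apply: le_trans (zge 0 0 (lexx _) (lexx _) t00).
    apply: ler_wpDr.
      rewrite mulr_ge0 ?mulr_ge0 ?powR_ge0 ?(ltW al0)//.
      by apply: Rintegral_ge0 => r /=; rewrite in_itv/= => /andP[r0 r1];
        apply: u0; rewrite r0 (le_trans r1) ?ltW.
    by apply: ler_pM => //; rewrite ?powR_ge0// divr_ge0// ltW.
  have H2 : eta * E * K / c <= (2 * tau) `^ (- al) / 4 * K0.
    rewrite ler_pdivrMr//.
    have : eta * E <= c * (2 * tau) `^ (- al) / 4.
      move: eE; rewrite ler_pdivlMr ?mulr_gt0// => eE.
      by rewrite ler_pdivlMr// -mulrA (mulrC E).
    move=> /(ler_wpM2r (ltW Kpos)) /le_trans; apply.
    have -> : (2 * tau) `^ (- al) / 4 * K0 * c = c * (2 * tau) `^ (- al) / 4 * K0 by ring.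
    by rewrite ler_wpM2l// !mulr_ge0// ltW.
  have := le_trans H1 H2.
  have : 0 < (2 * tau) `^ (- al) * K0 by rewrite mulr_gt0.
  by clear; lra.
pose r0 := t0 - tau.
have h0 : 0 < h by rewrite divr_gt0.
have hE : tau = 2 * h by rewrite /h; field.
have r0t : 0 <= r0 <= t0 by rewrite /r0; apply/andP; split; clear -t2 tp; lra.
have nup := nu0 tp.
have nuh : nu <= h by rewrite ge_min lexx.
have BK r : 0 <= r <= t0 -> t0 - 3 * tau <= r -> B r <= (1 + eta) * K.
  by move=> /andP[r_0 rt] r3; apply: Bslow => //; rewrite rt/= -lerBlDr.
have eK : eta * ((1 + eta) * K) <= K.
  rewrite mulrA ler_piMl ?(ltW Kpos)//.
  have : eta * (1 + eta) <= 2^-1 * 2 by apply: ler_pM => //; clear -e12 eta_gt0; lra.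
  by rewrite mulVf.
have XK : X + h `^ (- al) / (1 - al) < al * nu `^ (- al) / 2.
  have Ynu : Y <= nu `^ (- al).
    rewrite powRN -[leLHS]invrK lef_pV2 ?posrE ?invr_gt0 ?powR_gt0//.
    apply: (@le_trans _ _ ((Y `^ (- al^-1)) `^ al)).
      apply: ge0_ler_powR; rewrite ?nnegrE ?powR_ge0 ?(ltW al0) ?(ltW nup)//.
      by rewrite ge_min lexx orbT.
    by rewrite -powRrM mulNr mulVf ?gt_eqF// powR_inv1// ltW.
  rewrite ltr_pdivlMr// mulrC -ltr_pdivrMl//; apply: lt_le_trans Ynu.
  by rewrite /Y -[X in _ < X + 1]mulrA (mulrC al^-1) mulrA mulrAC ltrDl.
have drop := @no_sudden_drop R al h nu r0 K X (fun s => x s + B s)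
  (fun s => g s + B' s) al0 al1 nup nuh _ Kpos XK.
have : K / 2 < x r0 + B r0.
  apply: drop.
  - by rewrite /r0; clear -t2 hE; lra.
  - by apply: primitiveD; [exact: primitiveW px|exact: primitiveW pB].
  - move=> r /andP[r_0 rr0].
    have rt : 0 <= r <= t0 by rewrite r_0; move: r0t => /andP[_]; exact: le_trans.
    have := xB r rt; rewrite ler_norml => /andP[+ _]; rewrite lerNl -subr_ge0; clear; lra.
  - move=> r /andP[r_0 rr0].
    have rt : 0 < r <= t0 by rewrite r_0; move: r0t => /andP[_]; exact: le_trans.
    by have [] := abel_integrableD (xeq r rt).1 (aB r rt).1.
  - move=> r /andP[rh rr0].
    have rp : 0 < r by rewrite (lt_le_trans _ rh)// /r0; clear -t2 hE h0; lra.
    have rt : 0 < r <= t0 by rewrite rp; move: r0t => /andP[_]; exact: le_trans.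
    have [_ ->] := abel_integrableD (xeq r rt).1 (aB r rt).1.
    have r2 : t0 - 2 * tau <= r by rewrite (le_trans _ rh)// /r0; clear -hE h0; lra.
    have rt' : r <= t0 by case/andP: rt.
    have B2 : - K <= abel al r B'.
      apply: le_trans (aB r rt).2; rewrite lerN2.
      apply: le_trans eK; rewrite ler_pM2l//; apply: BK.
        by rewrite (ltW rp).
      by clear -r2 tp; lra.
    rewrite mulNr /X mulrDl opprD mul1r; apply: lerD => //.
    rewrite mulrAC lerNl ler_pdivlMr// mulNr lerNl (mulrC (abel _ _ _)).
    have xr : `|x r| <= 2 * K.
      apply: (@le_trans _ _ ((1 + eta) * K)); last by rewrite ler_pM2r//; clear -e12; lra.
      by apply: xlate; clear -r2 tp rp rt' t2; lra.
    have xrt : `|x (r - tau)| <= 2 * K.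
      apply: (@le_trans _ _ ((1 + eta) * K)); last by rewrite ler_pM2r//; clear -e12; lra.
      by apply: xlate; clear -r2 tp rp rt' t2; lra.
    have := rhsb r rt r2; rewrite ler_norml => /andP[+ _].
    have : `|delta * x (r - tau)| <= `|delta| * (2 * K) by rewrite normrM ler_wpM2l.
    have : `|a * x r| <= `|a| * (2 * K) by rewrite normrM ler_wpM2l.
    rewrite !ler_norml => /andP[_ H1] /andP[H2 _] H3.
    have : 4 * C * eta * K <= 4 * C * K.
      by rewrite ler_pM2r// ler_piMr ?mulr_ge0//; clear -e12; lra.
    by clear -H1 H2 H3; lra.
  - move=> r /andP[rh rr0].
    have ra : 0 <= r - nu by move: rh; rewrite /r0; clear -nuh h0 hE t2; lra.
    have ab : r - nu <= r - nu / 2 by clear -nup; lra.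
    have bt : r - nu / 2 < t0 by move: rr0; rewrite /r0; clear -nup tp; lra.
    have iB : mu.-integrable `[r - nu, r - nu / 2] (EFin \o B).
      by apply: primitive_integrable pB _ _ => //; rewrite ltW.
    have ix : mu.-integrable `[r - nu, r - nu / 2] (EFin \o x).
      by apply: primitive_integrable px _ _ => //; rewrite ltW.
    apply: (@le_trans _ _ (\int[mu]_(s in `[r - nu, r - nu / 2]) (B s - x s))).
      apply: le_Rintegral => //.
      + apply: integrableB_EFin => //; first exact: integrable_itv_cst.
        exact: integrableD_EFin.
      + exact: integrableB_EFin.
      + move=> s /=; rewrite in_itv/= => /andP[sa sb].
        have : K <= B s.
          by apply: Bdec; rewrite (le_trans ra sa)/= (le_trans sb)// ltW.
        by clear; lra.
    have J0 : 0 <= \int[mu]_(s in `[r - nu, r - nu / 2]) (B s - x s).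
      apply: Rintegral_ge0 => s /=; rewrite in_itv/= => /andP[sa sb].
      by apply: u0; rewrite (le_trans ra sa)/= (le_trans sb)// ltW.
    have tr0 : 0 < t0 - (r - nu) by clear -bt nup; lra.
    have H1 : al * (2 * tau) `^ (- al - 1) *
        \int[mu]_(s in `[r - nu, r - nu / 2]) (B s - x s) <= eta * E * K / c.
      apply: le_trans zE; apply: le_trans (zge _ _ ra ab bt).
      apply: ler_wpDl.
        by rewrite mulr_ge0 ?powR_ge0// u0// lexx ltW.
      apply: ler_wpM2r => //; apply: ler_wpM2l; first exact: ltW.
      have -> : - al - 1 = - (al + 1) by ring.
      rewrite !powRN lef_pV2 ?posrE ?powR_gt0//.
      apply: ge0_ler_powR; rewrite ?nnegrE ?(ltW tau2) ?(ltW tr0)//.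
        by rewrite addr_ge0// ltW.
      by move: rh; rewrite /r0; clear -hE nuh h0; lra.
    have q0 : 0 < c * al * (2 * tau) `^ (- al - 1) by rewrite !mulr_gt0 ?powR_gt0.
    rewrite -(ler_pM2l q0).
    have -> : c * al * (2 * tau) `^ (- al - 1) * (nu / 4 * K) =
      nu / 4 * (c * al * (2 * tau) `^ (- al - 1)) * K by ring.
    apply: (@le_trans _ _ (eta * E * K)).
      by move: H1; rewrite ler_pdivlMr//; clear; lra.
    by rewrite ler_pM2r// -ler_pdivlMr.
rewrite ltNge => /negP; apply.
have Br0 : B r0 <= (1 + eta) * K by apply: BK => //; rewrite /r0; clear -tp; lra.
have xr0 : x r0 <= (eta * E / D - 1) * K.
  have -> : (eta * E / D - 1) * K = (eta * E - D) * K / D by field; rewrite gt_eqF.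
  by rewrite ler_pdivlMr// mulrC.
have : eta * Q <= 2^-1.
  by rewrite (le_trans (ler_wpM2r (ltW Q0) eQ))// invfM -mulrA mulVf ?gt_eqF// mulr1.
rewrite /Q mulrDr mulr1 mulrA -(ler_pM2r Kpos).
by clear -Br0 xr0; lra.
Qed.

Lemma derive_ge0_left_max (R : realType) (f : R -> R) (a c d : R) : a < c ->
  is_derive c 1 f d -> (forall t, a < t <= c -> f t <= f c) -> 0 <= d.
Proof.
move=> ac [dfc <-] fmax.
rewrite ['D_1 f c]cvg_at_leftE//; apply: limr_ge.
  rewrite -(cvg_at_leftE (fun h => h^-1 *: ((f \o shift c) _ - f c))) //.
  apply: cvg_trans dfc; apply: cvg_app.
  move=> A [e egt0 Ae]; exists e => // x xe xgt0; apply: Ae => //.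
  exact/ltr0_neq0.
near=> h.
have h0 : h < 0 by near: h; exists 1 => /=.
have ha : a - c < h.
  near: h; exists (c - a); first by rewrite /= subr_gt0.
  move=> h; rewrite /= sub0r normrN => /ltr_normlP [hh _] _.
  by rewrite ltrNl opprB in hh.
apply: mulr_le0; first by rewrite invr_le0 ltW.
rewrite subr_le0 [_%:A]mulr1 /=; apply: fmax.
by rewrite -ltrBlDr ha/= gerDr ltW.
Unshelve. all: by end_near. Qed.

(** The case [alpha = 1]. The derivative has no memory, but the equation itself
    does the job: [x' <= a * (K - x)] up to small terms on the delay that precedes
    contact, so that going backwards [x] moves away from [K] slowly, which
    contradicts [contact_delayed] (or, for an early contact, the initial gap). *)
Lemma ode_no_contact (R : realType) (a delta tau C : R) (f : R -> R -> R) :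
  - a <= delta -> delta < a -> 0 <= tau -> 0 <= C ->
  (forall m u v, m <= 1 -> `|u| <= m -> `|v| <= m ->
    `|f u v - (delta * v - a * u)| <= C * m ^+ 2) ->
  exists2 eta0 : R, 0 < eta0 &
  forall (eta K0 t0 : R) (B B' x : R -> R),
  0 < eta -> eta <= eta0 -> K0 <= eta -> 0 < t0 ->
  slow_barrier eta (3 * tau) K0 B ->
  (forall t, 0 < t <= t0 -> is_derive t 1 B (B' t) /\ - (eta * B t) <= B' t) ->
  {within `[0, t0], continuous x} ->
  (forall t, 0 < t <= t0 -> is_derive t 1 x (f (x t) (x (t - tau)))) ->
  (forall s, - tau <= s <= 0 -> `|x s| <= K0 / 2) ->
  (forall s, 0 <= s <= t0 -> `|x s| <= B s) ->
  x t0 <> B t0.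
Proof.
move=> da ad tau0 C0 Hf.
have a0 : 0 < a by clear -da ad; lra.
have D0 := delay_margin_gt0 ad.
set D := delay_margin a delta in D0 *.
pose E := `|delta| + 4 * C + 1.
have E0 : 0 < E by rewrite ltr_pwDr// addr_ge0// mulr_ge0.
pose Q := 1 + E / D.
have Q0 : 0 < Q by rewrite addr_gt0// divr_gt0.
pose S := 4 * (E / a * expR (a * tau)).
have S0 : 0 < S by rewrite mulr_gt0// mulr_gt0 ?expR_gt0// divr_gt0.
pose eta0 := Num.min (4^-1) (Num.min (2 * Q)^-1 S^-1).
exists eta0; first by rewrite !lt_min !invr_gt0 S0 mulr_gt0// ltr0n.
move=> eta K0 t0 B B' x eta_gt0 + K0eta t00 slow dB cx dx xhist xB xt0.
rewrite !le_min => /and3P[e14 eQ eS].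
have e12 : eta <= 2^-1 by clear -e14; lra.
have [B0 Bpos Bdec Bslow] := slow.
set K := B t0 in xt0.
have Kpos : 0 < K by exact/Bpos/ltW.
have K0K : K <= K0 by rewrite -B0; apply: Bdec; rewrite lexx ltW.
have eQ2 : eta * Q <= 2^-1.
  by rewrite (le_trans (ler_wpM2r (ltW Q0) eQ))// invfM -mulrA mulVf ?gt_eqF// mulr1.
have eE1 : eta * E < D.
  move: eQ2; rewrite /Q mulrDr mulr1 => eQ'.
  have : eta * (E / D) < 1 by clear -eQ' eta_gt0; lra.
  by rewrite mulrA ltr_pdivrMr// mul1r.
have xlate s : - tau <= s -> t0 - 3 * tau <= s -> s <= t0 -> `|x s| <= (1 + eta) * K.
  exact: slow_barrier_window (ltW t00) slow xhist xB.
have rhsb t : 0 < t <= t0 -> t0 - tau <= t ->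
    `|f (x t) (x (t - tau)) - (delta * x (t - tau) - a * x t)| <= 4 * C * eta * K.
  move=> /andP[tp tt0] t2; apply: rhs_at_contact => //; first exact: ltW.
  - exact: le_trans K0K K0eta.
  - by apply: xlate; clear -tau0 t2 tp tt0; lra.
  - by apply: xlate; clear -tau0 t2 tp tt0; lra.
have t0t0 : 0 < t0 <= t0 by rewrite t00 lexx.
have vK : `|x (t0 - tau)| <= (1 + eta) * K.
  by apply: xlate; clear -tau0 t00; lra.
have t0tau : t0 - tau <= t0 by rewrite gerBl.
have FK := rhsb t0 t0t0 t0tau.
have F0 : 0 <= f (x t0) (x (t0 - tau)) + 1 * eta * K.
  have dz : is_derive t0 1 (x - B) (f (x t0) (x (t0 - tau)) - B' t0).
    by apply: is_deriveB; [exact: dx|exact: (dB _ t0t0).1].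
  have : 0 <= f (x t0) (x (t0 - tau)) - B' t0.
    apply: (derive_ge0_left_max t00 dz) => t /andP[tp tt].
    rewrite !fctE xt0 subrr subr_le0 (le_trans (ler_norm _))// xB//.
    by rewrite ltW.
  have := (dB _ t0t0).2; rewrite -/K mul1r; clear; lra.
rewrite xt0 in FK F0.
have [dn vD _] := contact_delayed da ad Kpos (ltW eta_gt0) eE1 vK FK F0.
rewrite -/E -/D in vD.
have xr0 : x (t0 - tau) <= - K / 2.
  have : x (t0 - tau) <= (eta * E / D - 1) * K.
    have -> : (eta * E / D - 1) * K = (eta * E - D) * K / D by field; rewrite gt_eqF.
    by rewrite ler_pdivlMr// mulrC.
  have : (eta * E / D) * K <= 2^-1 * K.
    rewrite ler_pM2r//; move: eQ2; rewrite /Q mulrDr mulr1 mulrA.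
    by clear -eta_gt0; lra.
  by clear; lra.
(* going backwards from the contact, x stays close to K *)
pose s0 := Num.max 0 (t0 - tau).
have s00 : 0 <= s0 by rewrite le_max lexx.
have s0t : s0 <= t0 by rewrite ge_max ltW//= gerBl.
have s0tau : t0 - tau <= s0 by rewrite le_max lexx orbT.
pose K2 := K + eta * E * K / a.
pose w := (fun s => expR (a * s)) * (fun s => x s - K2).
have de (t : R) : is_derive t 1 (fun s => expR (a * s)) (a * expR (a * t)).
  by apply: is_derive_eq; rewrite /GRing.scale/= mulr1 mulrC.
have dw t : s0 < t <= t0 -> is_derive t 1 w
    (expR (a * t) * (f (x t) (x (t - tau)) + a * (x t - K2))).
  move=> /andP[st tt].
  have tp : 0 < t <= t0 by rewrite (le_lt_trans s00 st).
  have dxt := dx t tp.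
  have det := de t.
  have dxK : is_derive t 1 (fun s => x s - K2) (f (x t) (x (t - tau))).
    by apply: is_derive_eq; rewrite subr0.
  by apply: is_derive_eq; rewrite /GRing.scale/=; ring.
have wle : w t0 <= w s0.
  apply: (@ler0_derive1_le_cc _ w s0 t0); rewrite ?in_itv/= ?lexx ?s0t//.
  - move=> t; rewrite in_itv/= => /andP[st tt].
    by have [] := dw t (ltac:(by rewrite st ltW)).
  - move=> t; rewrite in_itv/= => /andP[st tt].
    have [_] := dw t (ltac:(by rewrite st ltW)); rewrite derive1E => ->.
    rewrite pmulr_rle0 ?expR_gt0//.
    have tp : 0 < t <= t0 by rewrite (le_lt_trans s00 st)/= ltW.
    have := rhsb t tp (ltW (le_lt_trans s0tau st)).
    rewrite ler_norml => /andP[_].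
    have : `|x (t - tau)| <= (1 + eta) * K.
      by apply: xlate; clear -tau0 tt st s00 s0tau; lra.
    rewrite ler_norml => /andP[xt _].
    have : - delta * - x (t - tau) <= - delta * ((1 + eta) * K).
      by apply: ler_wpM2l; [clear -dn; lra|clear -xt; lra].
    have : a * K2 = a * K + eta * E * K by rewrite /K2; field; rewrite gt_eqF.
    have : - delta * K <= a * K by rewrite ler_pM2r//; clear -da; lra.
    have : 0 <= eta * K by rewrite mulr_ge0// ltW.
    have : E = - delta + 4 * C + 1 by rewrite /E ltr0_norm.
    rewrite mulrBr; move=> -> e1 e2 ->; clear -e1 e2; lra.
  - apply: continuous_subspaceW; last first.
      move=> t; apply: cvgM.
        apply: continuous_subspaceT => s.
        exact: (is_derive1_continuous (de s)).
      apply: cvgB; [exact: cx|exact: cvg_cst].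
    by apply: subset_itvr; rewrite bnd_simp.
have xs0 : 3 / 4 * K <= x s0.
  have := wle; rewrite /w !fctE xt0 => wle'.
  have es0 := expR_gt0 (a * s0).
  have K2K : K2 - K = eta * E * K / a by rewrite /K2; ring.
  have dK0 : 0 <= K2 - K by rewrite K2K divr_ge0 ?mulr_ge0// ltW.
  have ee : expR (a * t0) <= expR (a * tau) * expR (a * s0).
    rewrite -expRD ler_expR -mulrDr ler_pM2l//.
    by move: s0tau; clear; lra.
  have H1 : (K2 - K) * expR (a * t0) <= (K2 - K) * (expR (a * tau) * expR (a * s0)).
    exact: ler_wpM2l.
  have H2 : K2 - x s0 <= (K2 - K) * expR (a * tau).
    rewrite -(ler_pM2r es0); move: wle' H1; clear; lra.
  have H3 : (K2 - K) * expR (a * tau) <= 4^-1 * K.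
    rewrite K2K.
    have -> : eta * E * K / a * expR (a * tau) = eta * (S / 4) * K.
      by rewrite /S; field; rewrite gt_eqF.
    rewrite ler_pM2r// mulrA ler_pdivrMr// mulVf//.
    by rewrite -ler_pdivlMr// div1r.
  by move: H2 H3 dK0; clear; lra.
have [st|st] := leP tau t0.
  have s0E : s0 = t0 - tau by rewrite /s0 max_r// subr_ge0.
  rewrite s0E in xs0; move: xs0 xr0 Kpos; clear; lra.
have s0E : s0 = 0 by rewrite /s0 max_l// subr_le0 ltW.
have /xhist : - tau <= s0 <= 0 by rewrite s0E lexx oppr_le0 tau0.
have K0le : K0 <= (1 + eta) * K.
  rewrite -B0; apply: Bslow => //; rewrite ltW//=.
  by clear -st tau0; lra.
have : eta * K <= 4^-1 * K by rewrite ler_pM2r.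
rewrite ler_norml => H1 /andP[_]; move: H1 K0le xs0 Kpos; clear; lra.
Qed.

(** * Stability *)

(** The infimum of the times where [x] leaves the region below [B]. *)
Lemma first_contact (R : realType) (T : R) (x B : R -> R) :
  {within `[0, T], continuous x} -> {within `[0, T], continuous B} ->
  `|x 0| < B 0 -> (exists2 t, 0 <= t <= T & B t < `|x t|) ->
  exists t0, [/\ 0 < t0 <= T, `|x t0| = B t0 &
    forall s, 0 <= s <= t0 -> `|x s| <= B s].
Proof.
move=> cx cB x0B [t1 /andP[t10 t1T] xt1].
pose psi s := `|x s| - B s.
have cpsi : {within `[0, T], continuous psi}.
  move=> s; apply: cvgB; last exact: cB.
  exact: (cvg_norm (cx s)).
have psi_near s : 0 <= s <= T -> forall e, 0 < e ->
    exists2 d : R, 0 < d & forall r, 0 <= r <= T -> `|s - r| < d -> `|psi s - psi r| < e.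
  move=> sT e e0.
  have /subspace_continuousP /(_ s) := cpsi.
  rewrite /= in_itv/= sT => /(_ isT) /cvgrPdist_lt /(_ e e0).
  rewrite near_withinE => /nbhs_ballP[d /= d0 Hd].
  by exists d => // r rT sr; apply: Hd => //; rewrite /= in_itv.
pose S := [set s | 0 <= s <= T /\ 0 <= psi s].
have S1 : S t1 by split; [rewrite t10|rewrite subr_ge0 ltW].
have hS : has_inf S.
  by split; [exists t1|exists 0 => s [/andP[]]].
pose t0 := inf S.
have t00 : 0 <= t0 by apply: lb_le_inf; [exists t1|move=> s [/andP[]]].
have t0T : t0 <= T by rewrite (le_trans _ t1T)//; apply: ge_inf => //; exact: hS.2.
have t0i : 0 <= t0 <= T by rewrite t00.
have before s : 0 <= s -> s < t0 -> psi s < 0.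
  move=> s0 st; rewrite ltNge; apply/negP => ps.
  have : t0 <= s.
    apply: ge_inf; first exact: hS.2.
    by split=> //; rewrite s0 (le_trans (ltW st)).
  by rewrite leNgt st.
have p0 : psi 0 < 0 by rewrite subr_lt0.
have pt0 : psi t0 = 0.
  apply/eqP; rewrite eq_le; apply/andP; split; rewrite leNgt; apply/negP => pt.
  - have [d d0 Hd] := psi_near t0 t0i _ pt.
    have t0p : 0 < t0.
      rewrite lt_neqAle t00 andbT; apply/eqP => E.
      by move: pt; rewrite -E; move: p0; clear; lra.
    pose r := Num.max 0 (t0 - d / 2).
    have rt : r < t0 by rewrite gt_max t0p/= ltrBlDr ltrDl divr_gt0.
    have r0 : 0 <= r by rewrite le_max lexx.
    have pr := before r r0 rt.
    have := Hd r; rewrite r0 (le_trans (ltW rt) t0T) => /(_ isT).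
    have -> : `|t0 - r| < d.
      rewrite gtr0_norm ?subr_gt0// ltrBlDr -ltrBlDl.
      apply: (@lt_le_trans _ _ (t0 - d / 2)); last by rewrite le_max lexx orbT.
      by rewrite ltrD2l ltrN2 ltr_pdivrMr// ltr_pMr// ltr1n.
    by move=> /(_ isT) /ltr_normlP[_]; move: pr; clear; lra.
  - have pt' : 0 < - psi t0 by rewrite oppr_gt0.
    have [d d0 Hd] := psi_near t0 t0i _ pt'.
    have [s [sT ps] sd] := inf_adherent d0 hS.
    have ts : t0 <= s by apply: ge_inf => //; exact: hS.2.
    have := Hd s sT; rewrite ler0_norm ?subr_le0// opprB ltrBlDl => /(_ sd).
    by move=> /ltr_normlP[+ _]; move: ps; clear; lra.
exists t0; split.
- rewrite t0T andbT lt_neqAle t00 andbT; apply/eqP => E.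
  by move: p0 pt0; rewrite -E => /[swap] ->; rewrite ltxx.
- by apply/eqP; rewrite -subr_eq0; apply/eqP.
- move=> s /andP[s0]; rewrite le_eqVlt => /predU1P[->|st].
    by rewrite -subr_le0 -/(psi t0) pt0.
  by rewrite -subr_le0 ltW// before.
Qed.

Lemma cubic_rhs_linearized (R : realType) (delta epsilon p q m u v : R) :
  m <= 1 -> `|u| <= m -> `|v| <= m ->
  `|cubic_rhs delta epsilon p q u v - (delta * v - (- q) * u)| <=
    (`|epsilon| + `|p|) * m ^+ 2.
Proof.
move=> m1 um vm; have m0 : 0 <= m by rewrite (le_trans _ um).
have -> : cubic_rhs delta epsilon p q u v - (delta * v - (- q) * u) =
    - (epsilon * v ^+ 3) - p * u ^+ 2 by rewrite /cubic_rhs; ring.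
apply: le_trans (ler_normB _ _) _; rewrite mulrDl normrN.
rewrite [`|epsilon * _|]normrM [`|p * _|]normrM (normrX 3) (normrX 2).
apply: lerD; apply: ler_wpM2l => //; last by rewrite lerXn2r ?nnegrE.
apply: (@le_trans _ _ (`|v| ^+ 2)); last by rewrite lerXn2r ?nnegrE.
by rewrite exprS ler_piMl ?exprn_ge0// (le_trans vm).
Qed.

Lemma cubic_rhs_sign (R : realType) (delta epsilon p q u v s : R) :
  s = 1 \/ s = -1 ->
  s * cubic_rhs delta epsilon p q u v = cubic_rhs delta epsilon (s * p) q (s * u) (s * v).
Proof. by case=> ->; rewrite /cubic_rhs; ring. Qed.

Lemma solution_primitive (R : realType) (alpha tau : R) f phi (T : \bar R) x t :
  is_solution alpha tau f phi T x -> 0 <= t -> (t%:E < T)%E ->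
  primitive t x (derive1 x).
Proof.
move=> [_ ac _] t0 tT; split; first by have [] := ac t t0 tT.
move=> r /andP[r0 rt]; have [] := ac r r0 _ => //.
by apply: le_lt_trans tT; rewrite lee_fin.
Qed.

Lemma hist_norm_lt (R : realType) (tau k s : R) (phi : R -> R) :
  (hist_norm tau phi < k%:E)%E -> - tau <= s <= 0 -> `|phi s| <= k.
Proof.
move=> hk sI; rewrite -lee_fin; apply: le_trans (ltW hk).
by apply: ereal_sup_ubound; exists s => //=; rewrite in_itv.
Qed.

(** Both stability and attractivity are read off this bound, as [B] is at most
    [K] and tends to [0]. A contact from below is one from above for [- x], which
    solves the equation with [- p] in place of [p]. The exponent of the barrier
    must be at most [alpha] and [1 - alpha] for [decay'_abel]; [alpha * (1 - alpha)]
    is. *)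
Lemma barrier_bound (R : realType) (alpha delta epsilon p q tau : R) :
  0 < alpha -> alpha <= 1 -> delta + q < 0 -> q <= delta -> 0 <= tau ->
  exists2 eta0 : R, 0 < eta0 & forall K : R, 0 < K -> K <= eta0 ->
  exists B : R -> R, [/\ B t @[t --> +oo] --> 0,
    forall t, 0 <= t -> B t <= K &
    forall phi (T : \bar R) x, (hist_norm tau phi < (K / 2)%:E)%E ->
      is_solution alpha tau (cubic_rhs delta epsilon p q) phi T x ->
      forall t, 0 <= t -> (t%:E < T)%E -> `|x t| <= B t].
Proof.
move=> al0 al1 dq qd tau0.
have da : - - q <= delta by rewrite opprK.
have ad : delta < - q by clear -dq; lra.
have C0 (r : R) : 0 <= `|epsilon| + `|r| by rewrite addr_ge0.
have linear r := @cubic_rhs_linearized R delta epsilon r q.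
(* it suffices to exclude contact from above, for [x] and for [- x] *)
have reduce (K : R) (B : R -> R) : 0 < K -> B 0 = K ->
    (forall t, 0 <= t -> {within `[0, t], continuous B}) ->
    (forall phi (T : \bar R) (x : R -> R) (s t0 : R), s = 1 \/ s = -1 ->
      is_solution alpha tau (cubic_rhs delta epsilon p q) phi T x ->
      0 < t0 -> (t0%:E < T)%E ->
      (forall u, - tau <= u <= 0 -> `|s * x u| <= K / 2) ->
      (forall u, 0 <= u <= t0 -> `|s * x u| <= B u) -> s * x t0 <> B t0) ->
    forall phi (T : \bar R) x, (hist_norm tau phi < (K / 2)%:E)%E ->
      is_solution alpha tau (cubic_rhs delta epsilon p q) phi T x ->
      forall t, 0 <= t -> (t%:E < T)%E -> `|x t| <= B t.
  move=> K0 BK cB nocontact phi T x hphi sol t t0 tT; rewrite leNgt; apply/negP => xB.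
  have xphi u : - tau <= u <= 0 -> `|x u| <= K / 2.
    by have [xE _ _] := sol => uI; rewrite (xE u uI); exact: hist_norm_lt hphi uI.
  have cx := primitive_continuous t0 (solution_primitive sol t0 tT).
  have x0 : `|x 0| < B 0.
    rewrite BK; apply: le_lt_trans (xphi 0 _) _; first by rewrite lexx oppr_le0 tau0.
    by rewrite ltr_pdivrMr// ltr_pMr// ltr1n.
  have [|t1 [/andP[t10 t1t] xt1 xB1]] := first_contact cx (cB t t0) x0.
    by exists t => //; rewrite t0 lexx.
  have t1T : (t1%:E < T)%E by apply: le_lt_trans tT; rewrite lee_fin.
  have sgn : forall s : R, s = 1 \/ s = -1 -> s * x t1 <> B t1.
    move=> s s1; have ns u : `|s * x u| = `|x u|.
      by rewrite normrM; case: s1 => ->; rewrite ?normrN normr1 mul1r.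
    apply: (nocontact _ _ _ _ _ s1 sol t10 t1T) => u uI; rewrite ns.
      exact: xphi.
    exact: xB1.
  have [xp|xn] := leP 0 (x t1).
    by apply: (sgn 1); [left|rewrite mul1r -xt1 ger0_norm].
  by apply: (sgn (-1)); [right|rewrite mulN1r -xt1 ltr0_norm].
have [alpha1|alphaN1] := eqVneq alpha 1.
  have [e1 e10 H1] := ode_no_contact da ad tau0 (C0 _) (linear (1 * p)).
  have [e2 e20 H2] := ode_no_contact da ad tau0 (C0 _) (linear (-1 * p)).
  pose eta := Num.min e1 e2; have eta0 : 0 < eta by rewrite lt_min e10.
  exists eta => // K K0 Keta.
  have tau3 : 0 < 3 * tau + 1 by rewrite ltr_wpDl// mulr_ge0.
  pose k := eta / (3 * tau + 1).
  have k0 : 0 < k by rewrite divr_gt0.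
  have keta : k <= eta by rewrite ler_pdivrMr// ler_pMr// lerDr mulr_ge0.
  have kL : k * (3 * tau) <= eta.
    by rewrite mulrAC ler_pdivrMr// ler_pM2l// lerDl.
  have slow := decay_slow K0 k0 ltr01 (lexx 1) kL.
  have [B0 Bpos Bdec _] := slow.
  exists (decay K k 1); split.
  - exact: decay_cvg0.
  - by move=> t t0; rewrite -[leRHS]B0 Bdec// lexx.
  apply: reduce => //.
    move=> t t0; apply: (primitive_continuous t0); exact: decay_primitive.
  move=> phi T x s t0 s1 sol t00 t0T xh xB.
  have dB t : 0 < t <= t0 -> is_derive t 1 (decay K k 1) (decay' K k 1 t) /\
      - (eta * decay K k 1 t) <= decay' K k 1 t.
    move=> /andP[/ltW t_0 _]; split; first exact: is_derive_decay.
    apply: le_trans (decay'_ge K0 k0 ltr01 (lexx 1) t_0).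
    by rewrite lerN2 ler_pM2r// Bpos.
  have cx : {within `[0, t0], continuous (fun u => s * x u)}.
    move=> u; apply: cvgM; first exact: cvg_cst.
    exact: (primitive_continuous (ltW t00) (solution_primitive sol (ltW t00) t0T)).
  have dx t : 0 < t <= t0 -> is_derive t 1 (fun u => s * x u)
      (cubic_rhs delta epsilon (s * p) q (s * x t) (s * x (t - tau))).
    move=> /andP[tp tt]; have [_ _ eqn] := sol.
    have [] := eqn t tp (le_lt_trans (_ : t%:E <= t0%:E)%E t0T); first by rewrite lee_fin.
    rewrite /caputo_derivable /caputo alpha1 eqxx => dxt fx.
    rewrite -cubic_rhs_sign// -fx derive1E.
    have dxt' : is_derive t 1 x ('D_1 x t) by exact: DeriveDef.
    apply: is_derive_eq.
    by [].
  case: s1 => sE; subst s.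
    by apply: (H1 eta K t0 _ _ (fun u => 1 * x u) _ _ _ _ slow dB cx dx xh xB) => //; rewrite ge_min lexx.
  by apply: (H2 eta K t0 _ _ (fun u => -1 * x u) _ _ _ _ slow dB cx dx xh xB) => //; rewrite ge_min lexx orbT.
have al1' : alpha < 1 by rewrite lt_neqAle alphaN1.
pose c := (Gamma (1 - alpha))^-1.
have c0 : 0 < c by rewrite invr_gt0 Gamma_gt0// ?subr_gt0// gerBl ltW.
have [e1 e10 H1] := frac_no_contact al0 al1' c0 da ad tau0 (C0 _) (linear (1 * p)).
have [e2 e20 H2] := frac_no_contact al0 al1' c0 da ad tau0 (C0 _) (linear (-1 * p)).
pose eta := Num.min e1 e2; have eta0 : 0 < eta by rewrite lt_min e10.
exists eta => // K K0 Keta.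
have tau3 : 0 < 3 * tau + 1 by rewrite ltr_wpDl// mulr_ge0.
pose k := Num.min (eta / (3 * tau + 1)) (eta `^ alpha^-1).
have k0 : 0 < k by rewrite lt_min divr_gt0//= powR_gt0.
have kal : k `^ alpha <= eta.
  apply: (@le_trans _ _ ((eta `^ alpha^-1) `^ alpha)).
    apply: ge0_ler_powR; rewrite ?nnegrE ?powR_ge0 ?(ltW al0) ?(ltW k0)//.
    by rewrite ge_min lexx orbT.
  by rewrite -powRrM mulVf ?gt_eqF// powRr1// ltW.
have kL : k * (3 * tau) <= eta.
  apply: (@le_trans _ _ (eta / (3 * tau + 1) * (3 * tau))).
    by apply: ler_wpM2r; [rewrite mulr_ge0|rewrite ge_min lexx].
  by rewrite mulrAC ler_pdivrMr// ler_pM2l// lerDl.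
pose b := alpha * (1 - alpha).
have al1s : 0 < 1 - alpha by rewrite subr_gt0.
have b0 : 0 < b by rewrite mulr_gt0.
have bal : b <= alpha by rewrite ler_piMr ?(ltW al0)// gerBl ltW.
have bal1 : b <= 1 - alpha by rewrite ler_piMl ?(ltW al1s).
have b1 : b <= 1 by rewrite (le_trans bal).
have slow := decay_slow K0 k0 b0 b1 kL.
have [B0 Bpos Bdec _] := slow.
exists (decay K k b); split.
- exact: decay_cvg0.
- by move=> t t0; rewrite -[leRHS]B0 Bdec// lexx.
apply: reduce => //.
  by move=> t t0; apply: (primitive_continuous t0); exact: decay_primitive.
move=> phi T x s t0 s1 sol t00 t0T xh xB.
have aB t : 0 < t <= t0 -> abel_integrable alpha t (decay' K k b) /\
    - (eta * decay K k b t) <= abel alpha t (decay' K k b).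
  move=> /andP[tp _]; have [iB aB] := decay'_abel K0 k0 b0 al0 bal bal1 tp.
  split=> //; apply: le_trans aB.
  by rewrite lerN2 ler_pM2r// Bpos// ltW.
have px : primitive t0 (fun u => s * x u) (fun u => s * derive1 x u).
  by apply: primitiveZ; exact: solution_primitive sol (ltW t00) t0T.
have eqx t : 0 < t <= t0 -> abel_integrable alpha t (fun u => s * derive1 x u) /\
    c * abel alpha t (fun u => s * derive1 x u) =
    cubic_rhs delta epsilon (s * p) q (s * x t) (s * x (t - tau)).
  move=> /andP[tp tt]; have [_ _ eqn] := sol.
  have [] := eqn t tp (le_lt_trans (_ : t%:E <= t0%:E)%E t0T); first by rewrite lee_fin.
  rewrite /caputo_derivable /caputo (negbTE alphaN1) => ix fx.
  have [isx ->] := @abel_integrableZ _ alpha t s (derive1 x) ix.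
  by split=> //; rewrite -cubic_rhs_sign// -fx mulrCA.
have pB := decay_primitive K b k0 t0.
case: s1 => sE; subst s.
  by apply: (H1 eta K t0 _ _ (fun u => 1 * x u) _ _ _ _ _ slow pB aB px eqx xh xB) => //; rewrite ge_min lexx.
by apply: (H2 eta K t0 _ _ (fun u => -1 * x u) _ _ _ _ _ slow pB aB px eqx xh xB) => //; rewrite ge_min lexx orbT.
Qed.

Lemma zero_equilibrium (R : realType) (alpha tau : R) (f : R -> R -> R) :
  f 0 0 = 0 -> equilibrium alpha tau f 0.
Proof.
move=> f0.
have d0 s : derive1 (cst 0 : R -> R) s = 0 by rewrite derive1_cst.
have i0 t : mu.-integrable `[0, t] (EFin \o (cst 0 : R -> R)).
  exact: integrable_itv_cst.
split => //.
- move=> t t0 _; have -> : derive1 (cst 0 : R -> R) = cst 0 by exact/funext.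
  by split; [exact: i0|rewrite /= /Rintegral integral0 addr0].
- move=> t t0 _.
  have E : caputo_integrand alpha (cst 0) t = cst 0.
    by apply/funext => s; rewrite /caputo_integrand d0 mulr0.
  rewrite /caputo_derivable /caputo E f0; case: ifP => _; split => //.
  by rewrite /Rintegral integral0 mulr0.
Qed.

Theorem theorem3 (R : realType) (alpha delta epsilon p q : R) :
  0 < alpha -> alpha <= 1 ->
  delta + q < 0 -> q <= delta ->
  forall tau : R, 0 <= tau ->
    equilibrium alpha tau (cubic_rhs delta epsilon p q) 0 /\
    asymptotically_stable alpha tau (cubic_rhs delta epsilon p q) 0.
Proof.
move=> al0 al1 dq qd tau tau0; split.
  by apply: zero_equilibrium; rewrite /cubic_rhs; ring.
have [eta0 eta00 barrier] := barrier_bound epsilon p al0 al1 dq qd tau0.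
have sub0 phi : (fun t : R => phi t - 0) = phi :> (R -> R).
  by apply/funext => t; rewrite subr0.
split.
- move=> eta eta_gt0; pose K := Num.min eta0 (eta / 2).
  have K0 : 0 < K by rewrite lt_min eta00 divr_gt0.
  have [|B [_ BK bound]] := barrier K K0; first by rewrite ge_min lexx.
  exists (K / 2); first by rewrite divr_gt0.
  move=> phi; rewrite sub0 => hphi T x sol t t0 tT; rewrite subr0.
  apply: le_lt_trans (bound _ _ _ hphi sol t t0 tT) _.
  apply: le_lt_trans (BK t t0) _.
  by rewrite gt_min ltr_pdivrMr// ltr_pMr// ltr1n orbT.
- have [B [B0 _ bound]] := barrier eta0 eta00 (lexx _).
  exists (eta0 / 2); first by rewrite divr_gt0.
  move=> phi; rewrite sub0 => hphi x sol.
  apply/cvgrPdist_le => e e0; near=> t.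
  have t0 : 0 <= t by near: t; apply: nbhs_pinfty_ge; exact: num_real.
  rewrite sub0r normrN.
  apply: le_trans (bound _ _ _ hphi sol t t0 (ltry _)) _.
  apply: le_trans (ler_norm _) _; rewrite -normrN -sub0r.
  by near: t; move/cvgrPdist_le : B0; exact.
Unshelve. all: by end_near. Qed.
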